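(* Consider \textsc{LinALB} restricted to instances $(S,k)$ in which $S$ is reduced, i.e., no two distinct equations of $S$ have the same set of variables. Each of the following three special cases is fixed-parameter tractable (parameter $k$) and admits a kernel with $O(k^2)$ equations and variables: (1) there is a set $U$ of variables such that each equation of $S$ contains an odd number of variables from $U$; (2) there is a constant $r$ such that every equation of $S$ contains at most $r$ variables; (3) there is a constant $\rho$ such that every variable appears in at most $\rho$ equations of $S$.
   Context: \textsc{LinALB}: Instance: a system $S$ of $m$ linear equations $e_1,\dots,e_m$ over $\mathrm{GF}(2)$ in variables $z_1,\dots,z_n$, where $e_j$ is $\sum_{i\in I_j}z_i=b_j$ with $\emptyset\ne I_j\subseteq\{1,\dots,n\}$, $b_j\in\{0,1\}$, and each $e_j$ has a positive integral weight $w_j$; and a positive integer $k$. Parameter: $k$. Question: is there an assignment of values to the variables such that the total weight of satisfied equations is at least $W/2+k$, where $W=\sum_j w_j$? A kernel is a polynomial-time algorithm mapping an instance $(S,k)$ to an equivalent instance $(S',k')$ with $k'\le k$ whose size is bounded as stated (constants may depend on $r$ resp. $\rho$). *)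

(* Defs.v *)
From HB Require Import structures.
From mathcomp Require Import all_boot all_order all_algebra.

Set Implicit Arguments.
Unset Strict Implicit.
Unset Printing Implicit Defensive.

Import Order.TTheory GRing.Theory Num.Theory.

(** ** Model of computation

    The WHILE language over binary trees (N. D. Jones, Computability and
    Complexity from a Programming Perspective, MIT Press 1997).  The cost of an
    evaluation includes the size of every tree that is read, so values are
    charged as if they were copied in full: a computation of cost t only
    reads and builds trees of size at most t, and cost is polynomially related to
    Turing machine time in both directions. *)

Inductive tree : Type := Leaf | Node of tree & tree.

Fixpoint tsize (v : tree) : nat :=
  if v is Node a b then (tsize a + tsize b).+1 else 1.

Definition hd (v : tree) : tree := if v is Node a _ then a else Leaf.
Definition tl (v : tree) : tree := if v is Node _ b then b else Leaf.
Definition truth (v : tree) : bool := if v is Node _ _ then true else false.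

Inductive expr : Type :=
| Var of nat
| Nil
| Cons of expr & expr
| Hd of expr
| Tl of expr.

Inductive cmd : Type :=
| Assign of nat & expr
| Seq of cmd & cmd
| If of expr & cmd & cmd
| While of expr & cmd.

Definition store := nat -> tree.

Definition update (s : store) (x : nat) (v : tree) : store :=
  fun y => if y == x then v else s y.

Fixpoint eval (s : store) (e : expr) : tree :=
  match e with
  | Var x => s x
  | Nil => Leaf
  | Cons e1 e2 => Node (eval s e1) (eval s e2)
  | Hd e1 => hd (eval s e1)
  | Tl e1 => tl (eval s e1)
  end.

Fixpoint ecost (s : store) (e : expr) : nat :=
  match e with
  | Var x => (tsize (s x)).+1
  | Nil => 1
  | Cons e1 e2 => (ecost s e1 + ecost s e2).+1
  | Hd e1 | Tl e1 => (ecost s e1).+1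
  end.

(* exec c s t s' : started in s, the command c halts in s' with cost t. *)
Inductive exec : cmd -> store -> nat -> store -> Prop :=
| ExecAssign x e s :
    exec (Assign x e) s (ecost s e).+1 (update s x (eval s e))
| ExecSeq c1 c2 s1 s2 s3 t1 t2 :
    exec c1 s1 t1 s2 -> exec c2 s2 t2 s3 ->
    exec (Seq c1 c2) s1 (t1 + t2).+1 s3
| ExecIfTrue e c1 c2 s s' t :
    truth (eval s e) -> exec c1 s t s' ->
    exec (If e c1 c2) s (ecost s e + t).+1 s'
| ExecIfFalse e c1 c2 s s' t :
    ~~ truth (eval s e) -> exec c2 s t s' ->
    exec (If e c1 c2) s (ecost s e + t).+1 s'
| ExecWhileDone e c s :
    ~~ truth (eval s e) -> exec (While e c) s (ecost s e).+1 s
| ExecWhileStep e c s1 s2 s3 t1 t2 :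
    truth (eval s1 e) -> exec c s1 t1 s2 -> exec (While e c) s2 t2 s3 ->
    exec (While e c) s1 (ecost s1 e + t1 + t2).+1 s3.

(* Input and output are held in variable 0. *)
Definition runs (P : cmd) (input : tree) (t : nat) (output : tree) : Prop :=
  exists2 s, exec P (update (fun=> Leaf) 0 input) t s & s 0 = output.

(** ** Encodings *)

Definition enc_list (l : seq tree) : tree := foldr Node Leaf l.

Definition enc_bool (b : bool) : tree := if b then Node Leaf Leaf else Leaf.

(* Binary, least significant bit first; up_log 2 n.+1 is the bit length of n. *)
Definition enc_nat (n : nat) : tree :=
  enc_list [seq enc_bool (odd (n %/ 2 ^ i)) | i <- iota 0 (up_log 2 n.+1)].

Definition computable (f : nat -> nat) : Prop :=
  exists P : cmd, forall n, exists t, runs P (enc_nat n) t (enc_nat (f n)).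

(** ** Weighted linear systems over GF(2) *)

Record system : Type := System {
  nvar : nat;
  neqn : nat;
  vars : 'I_neqn -> {set 'I_nvar};
  rhs : 'I_neqn -> 'F_2;
  weight : 'I_neqn -> nat;
  vars_neq0 : forall j, vars j != set0;
  weight_gt0 : forall j, 0 < weight j
}.

Definition total_weight (S : system) : nat := \sum_(j < neqn S) weight j.

Definition satisfies (S : system) (z : 'I_(nvar S) -> 'F_2) (j : 'I_(neqn S))
    : bool :=
  (\sum_(i in vars j) z i == rhs j)%R.

Definition sat_weight (S : system) (z : 'I_(nvar S) -> 'F_2) : nat :=
  \sum_(j < neqn S | satisfies z j) weight j.

Definition linalb (S : system) (k : nat) : Prop :=
  exists z : 'I_(nvar S) -> 'F_2,
    ((total_weight S)%:R / 2 + k%:R <= (sat_weight z)%:R :> rat)%R.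

Definition reduced (S : system) : Prop := injective (@vars S).

Definition odd_on_some_set (S : system) : Prop :=
  exists U : {set 'I_(nvar S)}, forall j : 'I_(neqn S), odd #|vars j :&: U|.

Definition vars_per_eqn_le (r : nat) (S : system) : Prop :=
  forall j : 'I_(neqn S), #|vars j| <= r.

Definition eqns_per_var_le (rho : nat) (S : system) : Prop :=
  forall i : 'I_(nvar S), #|[set j : 'I_(neqn S) | i \in vars j]| <= rho.

(* The number of variables is written in unary and each equation as its 0/1
   coefficient row, right-hand side and weight in binary. *)
Definition enc_eqn (S : system) (j : 'I_(neqn S)) : tree :=
  Node (enc_list [seq enc_bool (i \in vars j) | i <- enum 'I_(nvar S)])
       (Node (enc_bool (rhs j != 0%R)) (enc_nat (weight j))).

Definition enc_instance (S : system) (k : nat) : tree :=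
  Node (enc_list (nseq (nvar S) Leaf))
       (Node (enc_list [seq enc_eqn j | j <- enum 'I_(neqn S)]) (enc_nat k)).

(** ** Parameterized complexity of LinALB on reduced systems in a class C *)

Definition fpt_on (C : system -> Prop) : Prop :=
  exists (P : cmd) (f : nat -> nat) (c : nat),
    computable f /\
    forall (S : system) (k : nat), reduced S -> C S -> 0 < k ->
      exists (t : nat) (b : bool),
        [/\ runs P (enc_instance S k) t (enc_bool b),
            t <= f k * tsize (enc_instance S k) ^ c
          & b <-> linalb S k].

Definition quadratic_kernel_on (C : system -> Prop) : Prop :=
  exists (P : cmd) (c d : nat),
    forall (S : system) (k : nat), reduced S -> C S -> 0 < k ->
      exists (t : nat) (S' : system) (k' : nat),
        [/\ runs P (enc_instance S k) t (enc_instance S' k'),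
            t <= c * tsize (enc_instance S k) ^ c,
            [/\ reduced S', C S' & 0 < k' <= k],
            linalb S k <-> linalb S' k'
          & neqn S' <= d * k ^ 2 /\ nvar S' <= d * k ^ 2].

(* Main.v *)
Require Import Defs.
From HB Require Import structures.
From mathcomp Require Import all_boot all_order all_algebra.
From mathcomp Require Import zify ring lra.
(* Defs.tsize is shadowed by tuple.tsize otherwise. *)
Import Defs.

Set Implicit Arguments.
Unset Strict Implicit.
Unset Printing Implicit Defensive.

Import Order.TTheory GRing.Theory Num.Theory.

(** Let X(z) be the weight satisfied by z minus the weight falsified; the question
    is whether max X >= 2k.  Over uniform z, X is a sum of distinct nontrivial
    characters with integer coefficients, so E X = 0 and E X^2 = sum w_j^2 >= m.
    In case (1) flipping the variables of U negates X, hence max X >= sqrt m.  In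
    cases (2) and (3) E X^4 <= K (E X^2)^2, with K = 9^r by Bonami's inequality and
    K = 1 + 2 rho by counting pairs of equations with a given symmetric difference;
    as E X = 0 this forces max X >= c sqrt m.  So m >= C k^2 implies YES, and
    otherwise deleting all columns outside a column basis, which changes
    neither the set of vectors A z nor the class, leaves at most m variables.

    Membership in polynomial time is established by closing a class of functions
    between encoded types under composition, pairing, conditionals and folds whose
    accumulator stays polynomially bounded.  Comparing m with C k^2 up to a
    factor 4 only needs the bit length of k, and fixed-parameter
    tractability is exhaustive search on the kernel. *)

(** * Polynomial-time functions on encoded types *)

(** A large variance alone does not bound max X from below: a variable of mean 0 can be hugely
    negative on a tiny set and barely positive elsewhere. Symmetry excludes this in case (1), the
    fourth moment in cases (2) and (3). Reducedness enters as orthogonality of the characters.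
    Columns are deleted, rather than rows combined, because deletion keeps every equation with its
    weight and cannot increase the counts bounded by r and rho. The substitute yes-instance must lie
    in the class too; this fails only for r = 0 or rho = 0, whose systems have no equations. Two
    size issues shape the algorithms. The number k is given in binary, so counting up to k^2 may
    take exponential time. The kernel keeps the weights, so its encoding is not bounded in k; the
    search is therefore charged a function of k times a polynomial in the size of the original
    input. Running times are proved for Rocq functions, the program being existentially quantified.
    The time of a fold is stated relative to an arbitrary bound on its accumulator, so that one
    lemma serves the polynomial loops and the exponential enumeration. *)

Structure encType : Type := EncType { esort :> Type; encode : esort -> tree }.
Arguments encode {e} _.

Canonical unit_encType := EncType (fun _ : unit => Leaf).
Canonical bool_encType := EncType enc_bool.
Canonical seq_encType (A : encType) :=
  @EncType (seq A) (fun l => enc_list [seq encode a | a <- l]).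
Canonical prod_encType (A B : encType) :=
  @EncType (A * B) (fun p => Node (encode p.1) (encode p.2)).

Definition esize (A : encType) (a : A) : nat := tsize (encode a).
Arguments esize {A} a.

Lemma tsize_gt0 v : 0 < tsize v. Proof. by case: v. Qed.
Lemma esize_gt0 (A : encType) (a : A) : 0 < esize a.
Proof. exact: tsize_gt0. Qed.
#[global] Hint Resolve tsize_gt0 esize_gt0 : core.

Lemma esize_pair (A B : encType) (a : A) (b : B) :
  esize (a, b) = (esize a + esize b).+1.
Proof. by []. Qed.

Lemma esize_nil (A : encType) : esize ([::] : seq A) = 1.
Proof. by []. Qed.

Lemma esize_cons (A : encType) (a : A) l :
  esize (a :: l) = (esize a + esize l).+1.
Proof. by []. Qed.

Lemma esize_bool (b : bool) : esize b <= 3.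
Proof. by case: b. Qed.

Lemma esize_unit (u : unit) : esize u = 1.
Proof. by case: u. Qed.

Lemma esize_cat (A : encType) (l1 l2 : seq A) :
  esize (l1 ++ l2) + 1 = esize l1 + esize l2.
Proof.
elim: l1 => [|a l IH] /=; first by rewrite esize_nil addnC.
by rewrite !esize_cons; lia.
Qed.

Lemma esize_behead (A : encType) (l : seq A) : esize (behead l) <= esize l.
Proof. by case: l => //= a l; rewrite esize_cons; lia. Qed.

Lemma size_le_esize (A : encType) (l : seq A) : size l < esize l.
Proof. by elim: l => //= a l IH; rewrite esize_cons; lia. Qed.

Lemma esize_bits (l : bitseq) : esize l <= 4 * size l + 1.
Proof.
by elim: l => //= a l IH; rewrite esize_cons; have := esize_bool a; lia.
Qed.

Lemma esize_take (A : encType) (l : seq A) i : esize (take i l) <= esize l.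
Proof. by rewrite -{2}(cat_take_drop i l); have := esize_cat (take i l) (drop i l);
  have := esize_gt0 (drop i l); lia. Qed.

(** * Polynomial bounds in the size of the encoded input *)

Section PolynomialBounds.

Variables (A : encType).
Implicit Types T : A -> nat.

(** One constant can be both factor and exponent: since [esize a] is positive, its powers increase
    with the exponent, so constants may be enlarged together. *)
Definition polyb T := exists c, forall a, T a <= c * esize a ^ c.

Lemma polyb_le T T' : (forall a, T a <= T' a) -> polyb T' -> polyb T.
Proof. by move=> le [c H]; exists c => a; apply: leq_trans (le a) (H a). Qed.

Lemma expn_esize_mono (a : A) m n : m <= n -> esize a ^ m <= esize a ^ n.
Proof. by move=> le; apply: leq_pexp2l. Qed.

Lemma polyb_const k : polyb (fun=> k).
Proof. by exists k => a; rewrite leq_pmulr // expn_gt0 esize_gt0. Qed.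

Lemma polyb_esize : polyb (@esize A).
Proof. by exists 1 => a; rewrite mul1n expn1. Qed.

Lemma polyb_add T1 T2 : polyb T1 -> polyb T2 -> polyb (fun a => T1 a + T2 a).
Proof.
move=> [c1 H1] [c2 H2]; exists (c1 + c2) => a.
have e1 := @expn_esize_mono a c1 (c1 + c2) (leq_addr _ _).
have e2 := @expn_esize_mono a c2 (c1 + c2) (leq_addl _ _).
rewrite mulnDl; apply: leq_add.
  by apply: leq_trans (H1 a) _; rewrite leq_mul2l e1 orbT.
by apply: leq_trans (H2 a) _; rewrite leq_mul2l e2 orbT.
Qed.

Lemma polyb_mul T1 T2 : polyb T1 -> polyb T2 -> polyb (fun a => T1 a * T2 a).
Proof.
move=> [c1 H1] [c2 H2]; exists (c1 * c2 + (c1 + c2)) => a.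
apply: leq_trans (leq_mul (H1 a) (H2 a)) _.
rewrite mulnACA -expnD; apply: leq_mul; first exact: leq_addr.
by apply: expn_esize_mono; exact: leq_addl.
Qed.

Lemma polyb_exp T n : polyb T -> polyb (fun a => T a ^ n).
Proof.
move=> pT; elim: n => [|n IH]; first exact: (polyb_const 1).
by apply: polyb_le (polyb_mul pT IH) => a; rewrite expnS.
Qed.

End PolynomialBounds.
Arguments polyb_const {A} k.
Arguments polyb_esize {A}.

Lemma polyb_comp (A B : encType) (T : B -> nat)
    (f : A -> B) : polyb T -> polyb (fun a => esize (f a)) ->
  polyb (fun a => T (f a)).
Proof.
move=> [c H] pf.
by apply: polyb_le (polyb_mul (polyb_const c) (polyb_exp c pf)) => a; exact: H.
Qed.

(** * Cost, size and composition of programs *)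

Lemma tsize_eval s e : tsize (eval s e) <= ecost s e.
Proof.
elim: e => [x||e1 IH1 e2 IH2|e IH|e IH] //=; first by lia.
  by case: (eval s e) IH => //= a b; lia.
by case: (eval s e) IH => //= a b; lia.
Qed.

(** Reading a tree costs its size, so no variable can grow by more than the elapsed time. Every
    bound on the size of an output is derived from this. *)
Lemma exec_size c s t s' : exec c s t s' -> forall y, tsize (s' y) <= tsize (s y) + t.
Proof.
elim=> {c s t s'} [x e s|c1 c2 s1 s2 s3 t1 t2 _ IH1 _ IH2|e c1 c2 s s' t _ _ IH
  |e c1 c2 s s' t _ _ IH|e c s _|e c s1 s2 s3 t1 t2 _ _ IH1 _ IH2] y.
- rewrite /update; case: (y == x); last by lia.
  by have := tsize_eval s e; lia.
- by have := IH1 y; have := IH2 y; lia.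
- by have := IH y; lia.
- by have := IH y; lia.
- by lia.
- by have := IH1 y; have := IH2 y; lia.
Qed.

(* The initial store is arbitrary away from variable 0 and the variables from n
   on are preserved; this is what makes programs composable. *)
Definition computes (A B : encType) (P : cmd) (n : nat)
    (T : A -> nat) (f : A -> B) : Prop :=
  0 < n /\ forall (s : store) (a : A), s 0 = encode a ->
    exists t s', [/\ exec P s t s', s' 0 = encode (f a),
      forall y, n <= y -> s' y = s y & t <= T a].

Definition polyf (A B : encType) (f : A -> B) : Prop :=
  exists P n T, polyb T /\ computes P n T f.

Lemma updateE s x v : update s x v x = v.
Proof. by rewrite /update eqxx. Qed.

Lemma updateN s x v y : y != x -> update s x v y = s y.
Proof. by rewrite /update => /negPf ->. Qed.

Lemma computes_size (A B : encType) P n T (f : A -> B) :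
  computes P n T f -> forall a, esize (f a) <= esize a + T a.
Proof.
move=> [n0 H] a.
have [t [s' [ex s0 _ le]]] := H (update (fun=> Leaf) 0 (encode a)) a (updateE _ _ _).
by have := exec_size ex 0; rewrite s0 updateE /esize; lia.
Qed.

Lemma polyf_size (A B : encType) (f : A -> B) : polyf f -> polyb (fun a => esize (f a)).
Proof.
move=> [P [n [T [pT cf]]]].
by apply: polyb_le (polyb_add polyb_esize pT) => a; exact: computes_size cf a.
Qed.

Section Combinators.

Variables (A B C : encType).

Lemma polyf_ext (f g : A -> B) : f =1 g -> polyf f -> polyf g.
Proof.
move=> eq [P [n [T [pT [n0 cf]]]]]; exists P, n, T; split=> //; split=> // s a sa.
by have [t [s' [? ? ? ?]]] := cf s a sa; exists t, s'; split=> //; rewrite -eq.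
Qed.

Lemma polyf_expr (e : expr) (T : A -> nat) (f : A -> B) : polyb T ->
  (forall s a, s 0 = encode a -> eval s e = encode (f a) /\ ecost s e <= T a) ->
  polyf f.
Proof.
move=> pT H; exists (Assign 0 e), 1, (fun a => T a + 1); split.
  exact: polyb_add pT (polyb_const 1).
split=> // s a sa; have [ev co] := H s a sa.
exists (ecost s e).+1, (update s 0 (eval s e)); split=> //.
- exact: ExecAssign.
- by move=> y y0; rewrite updateN //; lia.
- by rewrite addn1 ltnS.
Qed.

Lemma polyf_cast (f : A -> B) : (forall a, encode (f a) = encode a) -> polyf f.
Proof.
move=> H; apply: (@polyf_expr (Var 0) (fun a => esize a + 1)).
  exact: polyb_add polyb_esize (polyb_const 1).
by move=> s a sa /=; rewrite sa H /esize addn1.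
Qed.

Lemma polyf_const (b : B) : polyf (fun _ : A => b).
Proof.
pose q := fix q v := if v is Node v1 v2 then Cons (q v1) (q v2) else Nil.
have qE s v : eval s (q v) = v by elim: v => //= v1 -> v2 ->.
have qC s v : ecost s (q v) <= tsize v by elim: v => //= v1 IH1 v2 IH2; lia.
apply: (@polyf_expr (q (encode b)) (fun=> esize b)); first exact: polyb_const.
by move=> s a sa; rewrite qE; split=> //; exact: qC.
Qed.

Lemma computes_comp P Q m n T U (f : A -> B) (g : B -> C) :
  computes P m T f -> computes Q n U g ->
  computes (Seq P Q) (maxn m n) (fun a => T a + U (f a) + 1) (fun a => g (f a)).
Proof.
move=> [m0 cf] [n0 cg]; split; first by lia.
move=> s a sa; have [t1 [s1 [ex1 s1a fr1 le1]]] := cf s a sa.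
have [t2 [s2 [ex2 s2a fr2 le2]]] := cg s1 _ s1a.
exists (t1 + t2).+1, s2; split=> //; first exact: ExecSeq ex1 ex2.
- by move=> y; rewrite geq_max => /andP[my ny]; rewrite fr2 // fr1.
- by lia.
Qed.

Lemma polyf_comp (f : A -> B) (g : B -> C) : polyf g -> polyf f -> polyf (fun a => g (f a)).
Proof.
move=> [Q [n [U [pU cg]]]] pf; have sf := polyf_size pf.
case: pf => [P [m [T [pT cf]]]].
exists (Seq P Q), (maxn m n), (fun a => T a + U (f a) + 1); split.
  exact: polyb_add (polyb_add pT (polyb_comp pU sf)) (polyb_const 1).
exact: computes_comp cf cg.
Qed.

(** The registers [N] and [N.+1] lie beyond the reach of both programs: the input saved in [N]
    survives [P], and the first result saved in [N.+1] survives [Q]. *)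
Lemma computes_pair P Q m n T U (f : A -> B) (g : A -> C) (N := maxn m n) :
  computes P m T f -> computes Q n U g ->
  computes
    (Seq (Assign N (Var 0)) (Seq P (Seq (Assign N.+1 (Var 0))
      (Seq (Assign 0 (Var N)) (Seq Q (Assign 0 (Cons (Var N.+1) (Var 0))))))))
    N.+2 (fun a => T a + U a + 2 * (esize a + esize (f a) + esize (g a)) + 20)
    (fun a => (f a, g a)).
Proof.
move=> [m0 cf] [n0 cg]; split=> // s a sa.
have [mN nN] : m <= N /\ n <= N by rewrite /N; lia.
pose s1 := update s N (s 0).
have s10 : s1 0 = encode a by rewrite /s1 updateN ?sa //; lia.
have [t1 [s2 [ex1 s20 fr1 le1]]] := cf s1 a s10.
pose s3 := update s2 N.+1 (s2 0); pose s4 := update s3 0 (s3 N).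
have s40 : s4 0 = encode a.
  rewrite /s4 updateE /s3 updateN; last by lia.
  by rewrite fr1 // /s1 updateE sa.
have [t2 [s5 [ex2 s50 fr2 le2]]] := cg s4 a s40.
have s5N : s5 N.+1 = encode (f a).
  by rewrite fr2; [rewrite /s4 updateN // /s3 updateE s20|lia].
do 2 eexists; split.
- apply: ExecSeq (ExecAssign _ _ _) _; rewrite /= -/s1.
  apply: ExecSeq ex1 _.
  apply: ExecSeq (ExecAssign _ _ _) _; rewrite /= -/s3.
  apply: ExecSeq (ExecAssign _ _ _) _; rewrite /= -/s4.
  exact: ExecSeq ex2 (ExecAssign _ _ _).
- by rewrite updateE /= s5N s50.
- move=> y yN; rewrite updateN; last by lia.
  rewrite fr2; last by lia.
  rewrite /s4 updateN; last by lia.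
  rewrite /s3 updateN; last by lia.
  by rewrite fr1; [rewrite /s1 updateN //; lia | lia].
- have s3N : s3 N = encode a.
    rewrite /s3 updateN; last by lia.
    by rewrite fr1 // /s1 updateE sa.
  rewrite /= -/s1 -/s3 s5N s50 s3N sa s20; rewrite /esize; lia.
Qed.

Lemma polyf_pair (f : A -> B) (g : A -> C) : polyf f -> polyf g ->
  polyf (fun a => (f a, g a)).
Proof.
move=> pf pg; have sf := polyf_size pf; have sg := polyf_size pg.
case: pf => [P [m [T [pT cf]]]]; case: pg => [Q [n [U [pU cg]]]].
have := computes_pair cf cg; set N := maxn m n => H.
do 3 eexists; split; last exact: H.
apply: polyb_add (polyb_const _); apply: polyb_add; first exact: polyb_add.
apply: polyb_mul (polyb_const _) _; apply: polyb_add sg.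
by apply: polyb_add sf; exact: polyb_esize.
Qed.

End Combinators.

Lemma polyf_fst (A B : encType) : polyf (@fst A B).
Proof.
apply: (@polyf_expr _ _ (Hd (Var 0)) (fun a => esize a + 2)).
  exact: polyb_add polyb_esize (polyb_const _).
by move=> s a sa /=; rewrite sa /esize; split=> //; lia.
Qed.

Lemma polyf_snd (A B : encType) : polyf (@snd A B).
Proof.
apply: (@polyf_expr _ _ (Tl (Var 0)) (fun a => esize a + 2)).
  exact: polyb_add polyb_esize (polyb_const _).
by move=> s a sa /=; rewrite sa /esize; split=> //; lia.
Qed.

(** The test is computed paired with the identity, which keeps the input available for the chosen
    branch. *)
Lemma polyf_if (A B : encType) (c : A -> bool)
    (f g : A -> B) : polyf c -> polyf f -> polyf g ->
  polyf (fun a => if c a then f a else g a).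
Proof.
move=> pc [P [m [T [pT [m0 cf]]]]] [Q [n [U [pU [n0 cg]]]]].
have := polyf_pair pc (@polyf_cast A A id (fun=> erefl)).
move=> [R [r [V [pV [r0 cr]]]]].
pose N := maxn r (maxn m n); have [rN mN nN] : [/\ r <= N, m <= N & n <= N].
  by rewrite /N; split; lia.
exists (Seq R (Seq (Assign N (Hd (Var 0)))
  (Seq (Assign 0 (Tl (Var 0))) (If (Var N) P Q)))), N.+1,
  (fun a => V a + T a + U a + 2 * esize a + 100); split.
  apply: polyb_add (polyb_const _); apply: polyb_add; first exact: polyb_add (polyb_add pV pT) pU.
  by apply: polyb_mul (polyb_const _) _; exact: polyb_esize.
split=> // s a sa; have [t1 [s1 [ex1 s10 fr1 le1]]] := cr s a sa.
pose s2 := update s1 N (hd (s1 0)); pose s3 := update s2 0 (tl (s2 0)).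
have s20 : s2 0 = Node (enc_bool (c a)) (encode a) by rewrite /s2 updateN ?s10 //; lia.
have s30 : s3 0 = encode a by rewrite /s3 updateE s20.
have s3N : s3 N = enc_bool (c a).
  by rewrite /s3 updateN; [rewrite /s2 updateE s10 | lia].
have fr3 y : N < y -> s3 y = s y.
  move=> Ny; rewrite /s3 updateN; last by lia.
  rewrite /s2 updateN; last by lia.
  by rewrite fr1 //; lia.
have cb : tsize (enc_bool (c a)) <= 3 by case: (c a).
case: ifP => ca.
- have [t2 [s4 [ex2 s40 fr2 le2]]] := cf s3 a s30.
  do 2 eexists; split.
  + apply: ExecSeq ex1 _.
    apply: ExecSeq (ExecAssign _ _ _) _; rewrite /= -/s2.
    apply: ExecSeq (ExecAssign _ _ _) _; rewrite /= -/s3.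
    by apply: ExecIfTrue ex2; rewrite /= s3N ca.
  + by [].
  + by move=> y Ny; rewrite fr2 ?fr3 //; lia.
  + rewrite /= -/s2 -/s3 s3N s20 s10 /=.
    by rewrite /esize; lia.
- have [t2 [s4 [ex2 s40 fr2 le2]]] := cg s3 a s30.
  do 2 eexists; split.
  + apply: ExecSeq ex1 _.
    apply: ExecSeq (ExecAssign _ _ _) _; rewrite /= -/s2.
    apply: ExecSeq (ExecAssign _ _ _) _; rewrite /= -/s3.
    by apply: ExecIfFalse ex2; rewrite /= s3N ca.
  + by [].
  + by move=> y Ny; rewrite fr2 ?fr3 //; lia.
  + rewrite /= -/s2 -/s3 s3N s20 s10 /=.
    by rewrite /esize; lia.
Qed.

(** * Folds over lists as loops *)

Section Fold.

Variables (X B A : encType).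
Variables (P : cmd) (n : nat) (T : X * (B * A) -> nat) (step : X -> B -> A -> B).
Hypothesis cP : computes P n T (fun p => step p.1 p.2.1 p.2.2).

(** Registers [n], [n.+1] and [n.+2] hold the parameter, the accumulator and the rest of the list,
    all out of reach of the step program [P]. *)
Let body := Seq (Assign 0 (Cons (Var n) (Cons (Var n.+1) (Hd (Var n.+2)))))
  (Seq P (Seq (Assign n.+1 (Var 0)) (Assign n.+2 (Tl (Var n.+2))))).

Definition fold_cmd : cmd :=
  Seq (Assign n (Hd (Var 0))) (Seq (Assign n.+1 (Hd (Tl (Var 0))))
  (Seq (Assign n.+2 (Tl (Tl (Var 0)))) (Seq (While (Var n.+2) body)
  (Assign 0 (Var n.+1))))).

(** Only accumulators reached on prefixes of [l] are bounded, so invariants special to the actual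
    run may be used. *)
Definition fold_bounded (M : nat) (x : X) (b : B) (l : seq A) : Prop :=
  [/\ esize x <= M, esize l <= M,
      forall i, esize (foldl (step x) b (take i l)) <= M
    & forall i a l', drop i l = a :: l' ->
        T (x, (foldl (step x) b (take i l), a)) <= M].

Lemma fold_bounded_cons M x b a l :
  fold_bounded M x b (a :: l) -> fold_bounded M x (step x b a) l.
Proof.
move=> [xM lM bM TM]; split=> //.
- by move: lM; rewrite esize_cons; lia.
- by move=> i; exact: (bM i.+1).
- by move=> i a' l'; exact: (TM i.+1).
Qed.

Lemma exec_fold_loop M x l b s : fold_bounded M x b l ->
  s n = encode x -> s n.+1 = encode b -> s n.+2 = encode l ->
  exists t s', [/\ exec (While (Var n.+2) body) s t s',
    s' n.+1 = encode (foldl (step x) b l),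
    forall y, n.+3 <= y -> s' y = s y & t <= (size l).+1 * (40 * M)].
Proof.
case: cP => n0 HP; elim: l b s => [|a l IH] b s bd sx sb sl.
  exists (ecost s (Var n.+2)).+1, s; split=> //.
  - by apply: ExecWhileDone; rewrite /= sl.
  - by case: bd => xM _ _ _; have := esize_gt0 x; rewrite /= sl /=; lia.
have bd' := fold_bounded_cons bd.
case: bd => xM lM bM TM.
pose s1 := update s 0 (encode (x, (b, a))).
have [t1 [s2 [ex2 s20 fr2 le2]]] := HP s1 (x, (b, a)) (updateE _ _ _).
pose s3 := update s2 n.+1 (s2 0); pose s4 := update s3 n.+2 (tl (s3 n.+2)).
have s3l : s3 n.+2 = encode (a :: l).
  rewrite /s3 updateN; last by lia.
  by rewrite fr2; [rewrite /s1 updateN //; lia|lia].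
have [||| t2 [s5 [ex5 s50 fr5 le5]]] := IH (step x b a) s4 bd'.
- rewrite /s4 updateN /s3; last by lia.
  rewrite updateN; last by lia.
  by rewrite fr2 // /s1 updateN //; lia.
- by rewrite /s4 updateN; [rewrite /s3 updateE s20 | lia].
- by rewrite /s4 updateE s3l.
do 2 eexists; split.
- apply: ExecWhileStep ex5; first by rewrite /= sl.
  apply: ExecSeq; first exact: ExecAssign.
  rewrite /= sx sb sl /= -/(encode (x, (b, a))) -/s1.
  exact: ExecSeq ex2 (ExecSeq (ExecAssign _ _ _) (ExecAssign _ _ _)).
- by rewrite s50.
- move=> y ny; rewrite fr5 // /s4 updateN; last by lia.
  rewrite /s3 updateN; last by lia.
  by rewrite fr2; [rewrite /s1 updateN //; lia | lia].
- rewrite /= -/s3 sx sb sl s3l s20 /=.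
  have := bM 0; have := bM 1; have := TM 0 a l erefl; rewrite take0 /= take0 /=.
  have := lM; rewrite esize_cons /= => HA HB HC HD.
  have -> : tsize (encode (step x b a)) = esize (step x b a) by [].
  rewrite -!/(esize _) mulSn.
  change (tsize (encode a)) with (esize a).
  change (tsize (enc_list [seq encode i | i <- l])) with (esize l).
  move: le5 le2 => /= le5 le2.
  have := esize_gt0 x; lia.
Qed.

Lemma computes_fold (Y : encType) Q m V (x : Y -> X) (b : Y -> B)
    (l : Y -> seq A) (M : Y -> nat) :
  computes Q m V (fun y => (x y, (b y, l y))) ->
  (forall y, fold_bounded (M y) (x y) (b y) (l y)) ->
  computes (Seq Q fold_cmd) (maxn m n.+3)
    (fun y => V y + (size (l y)).+1 * (40 * M y) +
      10 * (esize (x y) + esize (b y) + esize (l y) + M y) + 200)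
    (fun y => foldl (step (x y)) (b y) (l y)).
Proof.
move=> [m0 cQ] bd; split; first by lia.
move=> s0 y sy; have n0 : 0 < n by case: cP.
have [t0 [s [ex0 sa fr0 le0]]] := cQ s0 y sy; have := bd y => {cQ bd}.
move: (x y) (b y) (l y) sa => {}x {}b {}l sa bd.
pose s1 := update s n (encode x); pose s2 := update s1 n.+1 (encode b).
pose s3 := update s2 n.+2 (encode l).
have s10 : s1 0 = Node (encode x) (Node (encode b) (encode l)).
  by rewrite /s1 updateN ?sa //; lia.
have s20 : s2 0 = Node (encode x) (Node (encode b) (encode l)).
  by rewrite /s2 updateN ?s10 //; lia.
have [||| t [s4 [ex4 s4b fr4 le4]]] := @exec_fold_loop _ x l b s3 bd.
- rewrite /s3 updateN; last by lia.
  by rewrite /s2 updateN; [rewrite /s1 updateE | lia].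
- by rewrite /s3 updateN; [rewrite /s2 updateE | lia].
- by rewrite /s3 updateE.
do 2 eexists; split.
- apply: ExecSeq ex0 _.
  apply: ExecSeq (ExecAssign _ _ _) _; rewrite /= sa /= -/s1.
  apply: ExecSeq (ExecAssign _ _ _) _; rewrite /= s10 /= -/s2.
  apply: ExecSeq (ExecAssign _ _ _) _; rewrite /= s20 /= -/s3.
  exact: ExecSeq ex4 (ExecAssign _ _ _).
- by rewrite updateE /= s4b.
- move=> v; rewrite geq_max => /andP[mv nv].
  rewrite updateN; last by lia.
  rewrite fr4 // /s3 updateN; last by lia.
  rewrite /s2 updateN; last by lia.
  by rewrite /s1 updateN ?fr0 //; lia.
- rewrite /= sa s10 s20 s4b /=.
  have [xM lM bM TM] := bd.
  have := bM (size l); rewrite take_size => bM'.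
  move: xM lM bM' le4 le0; rewrite /esize.
  change (enc_list [seq encode a | a <- l]) with (encode l); lia.
Qed.

End Fold.

Section PolyFold.

Variables (X B A Y : encType).
Variable step : X -> B -> A -> B.
Variables (x : Y -> X) (b : Y -> B) (l : Y -> seq A).
Hypothesis pstep : polyf (fun p => step p.1 p.2.1 p.2.2).

(** The program and the constant are fixed before the accumulator bound [U]. A polynomial [U] gives
    polynomial time; an exponential one still gives a usable bound for the enumeration of
    assignments. *)
Lemma foldl_time : polyf x -> polyf b -> polyf l ->
  exists P n c, forall U : Y -> nat,
    (forall y i, esize (foldl (step (x y)) (b y) (take i (l y))) <= U y) ->
    computes P n (fun y => c * (esize y + U y) ^ c)
      (fun y => foldl (step (x y)) (b y) (l y)).
Proof.
move=> px pb pl; have pi := polyf_pair px (polyf_pair pb pl).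
have sx := polyf_size px; have sb := polyf_size pb; have sl := polyf_size pl.
case: pi => [Q [m [V [pV cQ]]]].
case: pstep => [P [n [T [[c cT] cP]]]].
(* Bounds in the two parameters esize y and U y are bounds over Y * seq unit. *)
have pl1 (W : Y -> nat) : polyb W -> polyb (fun q : Y * seq unit => W q.1).
  move=> pW; apply: polyb_comp => //.
  by apply: polyb_le polyb_esize => -[y u]; rewrite esize_pair /=; lia.
have pl2 : polyb (fun q : Y * seq unit => size q.2).
  apply: polyb_le polyb_esize => -[y u]; rewrite esize_pair /=.
  by apply: leq_trans (ltnW (size_le_esize u)) _; lia.
pose K y u := esize (x y) + esize (l y) + u + 10.
pose M y u := K y u + c * (3 * K y u) ^ c.
pose F y u := V y + (esize (l y)).+1 * (40 * M y u) +
      10 * (esize (x y) + esize (b y) + esize (l y) + M y u) + 200.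
have pK : polyb (fun q : Y * seq unit => K q.1 (size q.2)).
  apply: polyb_add (polyb_const _); apply: polyb_add => //.
  by apply: polyb_add; [exact: (pl1 _ sx) | exact: (pl1 _ sl)].
have pM : polyb (fun q : Y * seq unit => M q.1 (size q.2)).
  apply: polyb_add => //; apply: polyb_mul (polyb_const _) _.
  by apply: polyb_exp; apply: polyb_mul (polyb_const _) pK.
have [C HC] : polyb (fun q : Y * seq unit => F q.1 (size q.2)).
  apply: polyb_add (polyb_const _); apply: polyb_add.
    apply: polyb_add; first exact: (pl1 _ pV).
    apply: polyb_mul; last by apply: polyb_mul => //; exact: polyb_const.
    apply: (pl1 (fun y => (esize (l y)).+1)).
    by apply: polyb_le (polyb_add (polyb_const 1) sl) => a; lia.
  apply: polyb_mul; first exact: polyb_const.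
  apply: polyb_add => //; apply: polyb_add; last exact: (pl1 _ sl).
  by apply: polyb_add; [exact: (pl1 _ sx) | exact: (pl1 _ sb)].
(* The pair [(y, nseq u tt)] has size [esize y + 2 * u + 2], at most five times [esize y + u]; hence
   the factor [5 ^ C]. *)
have {}HC y u : F y u <= C * 5 ^ C * (esize y + u) ^ (C * 5 ^ C).
  have := HC (y, nseq u tt); rewrite /= size_nseq => H; apply: leq_trans H _.
  have -> : esize (y, nseq u tt) = esize y + 2 * u + 2.
    rewrite esize_pair; suff -> : esize (nseq u tt) = (2 * u).+1 by lia.
    by elim: u => //= u IH; rewrite esize_cons esize_unit IH; lia.
  rewrite -mulnA leq_mul2l; apply/orP; right.
  have y0 := esize_gt0 y.
  apply: (@leq_trans ((5 * (esize y + u)) ^ C)).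
    by case: (C) => // C'; rewrite leq_exp2r //; lia.
  rewrite expnMn leq_mul2l; apply/orP; right; apply: leq_pexp2l; first by lia.
  by rewrite leq_pmulr // expn_gt0.
exists (Seq Q (fold_cmd P n)), (maxn m n.+3), (C * 5 ^ C) => U bU.
have bd y : fold_bounded T step (M y (U y)) (x y) (b y) (l y).
  split; try by rewrite /M /K; lia.
  - by move=> i; have := bU y i; rewrite /M /K; lia.
  - move=> i a l' dr; apply: leq_trans (cT _) _; rewrite /M.
    apply: leq_trans (leq_addl _ _); rewrite leq_mul2l; apply/orP; right.
    set k := K _ _.
    have Hk : esize (x y, (foldl (step (x y)) (b y) (take i (l y)), a)) <= 3 * k.
      rewrite !esize_pair; have := esize_cat (take i (l y)) (drop i (l y)).
      rewrite cat_take_drop dr esize_cons.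
      by have := bU y i; have := esize_gt0 (take i (l y)); rewrite /k /K; lia.
    by case: (c) => // c'; rewrite leq_exp2r.
have [N0 H] := computes_fold cP cQ bd; split=> // s y sy.
have [t [s' [h1 h2 h3 h4]]] := H s y sy; exists t, s'; split=> //.
apply: leq_trans h4 (leq_trans _ (HC y (U y))); rewrite /F.
have h : (size (l y)).+1 * (40 * M y (U y)) <= (esize (l y)).+1 * (40 * M y (U y)).
  by rewrite leq_mul2r ltnS (ltnW (size_le_esize (l y))) orbT.
lia.
Qed.

Lemma polyf_foldl_bounded : polyf x -> polyf b -> polyf l ->
  (exists2 U, polyb U & forall y i,
     esize (foldl (step (x y)) (b y) (take i (l y))) <= U y) ->
  polyf (fun y => foldl (step (x y)) (b y) (l y)).
Proof.
move=> px pb pl [U pU bU]; have [P [n [c H]]] := foldl_time px pb pl.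
exists P, n, (fun y => c * (esize y + U y) ^ c); split; last exact: H.
apply: polyb_mul (polyb_const _) _; apply: polyb_exp; apply: polyb_add => //.
exact: polyb_esize.
Qed.

(** The growth per step must not depend on the accumulator: increments then add up to a polynomial,
    whereas a step that doubles its accumulator would reach exponential size. *)
Lemma polyf_foldl : polyf x -> polyf b -> polyf l ->
  (exists c, forall x b a, esize (step x b a) <= esize b + c * (esize x + esize a) ^ c) ->
  polyf (fun y => foldl (step (x y)) (b y) (l y)).
Proof.
move=> px pb pl [c Hc]; apply: polyf_foldl_bounded => //.
have sx := polyf_size px; have sb := polyf_size pb; have sl := polyf_size pl.
exists (fun y => esize (b y) + esize (l y) * (c * (esize (x y) + esize (l y)) ^ c)).
  apply: polyb_add => //; apply: polyb_mul => //.
  by apply: polyb_mul (polyb_const _) _; apply: polyb_exp; apply: polyb_add.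
move=> y i; apply: (@leq_trans (esize (b y) + size (take i (l y)) *
    (c * (esize (x y) + esize (take i (l y))) ^ c))); last first.
  rewrite leq_add2l; apply: leq_mul.
    by apply: ltnW; apply: leq_trans (size_le_esize _) (esize_take _ _).
  rewrite leq_mul2l; apply/orP; right.
  by case: (c) => // c'; rewrite leq_exp2r // leq_add2l esize_take.
elim: {i}(take i (l y)) (b y) => [|a l' IH] b' /=; first by lia.
apply: leq_trans (IH _) _; rewrite mulSn addnA.
have H1 d : d <= esize (a :: l') ->
    c * (esize (x y) + d) ^ c <= c * (esize (x y) + esize (a :: l')) ^ c.
  move=> le; rewrite leq_mul2l; apply/orP; right.
  by case: (c) => // c'; rewrite leq_exp2r // leq_add2l.
apply: leq_add; last first.
  by rewrite leq_mul2l; apply/orP; right; apply: H1; rewrite esize_cons; lia.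
by apply: leq_trans (Hc _ _ _) _; rewrite leq_add2l; apply: H1; rewrite esize_cons; lia.
Qed.

End PolyFold.

(** * Derived polynomial-time operations on lists, bit vectors and numerals *)

Lemma polyf_id (A : encType) : polyf (fun a : A => a).
Proof. exact: polyf_cast. Qed.

Lemma polyf_fst_comp (A B C : encType) (f : A -> B * C) : polyf f -> polyf (fun a => (f a).1).
Proof. exact: (polyf_comp (@polyf_fst B C)). Qed.

Lemma polyf_snd_comp (A B C : encType) (f : A -> B * C) : polyf f -> polyf (fun a => (f a).2).
Proof. exact: (polyf_comp (@polyf_snd B C)). Qed.

Lemma polyf_comp2 (A B C D : encType) (g : B -> C -> D) (f1 : A -> B) (f2 : A -> C) :
  polyf (fun p : B * C => g p.1 p.2) -> polyf f1 -> polyf f2 ->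
  polyf (fun a => g (f1 a) (f2 a)).
Proof. by move=> pg p1 p2; exact: polyf_comp pg (polyf_pair p1 p2). Qed.

Lemma polyf_comp3 (A B C D E : encType) (g : B -> C -> D -> E) (f1 : A -> B)
    (f2 : A -> C) (f3 : A -> D) :
  polyf (fun p : B * (C * D) => g p.1 p.2.1 p.2.2) ->
  polyf f1 -> polyf f2 -> polyf f3 -> polyf (fun a => g (f1 a) (f2 a) (f3 a)).
Proof.
move=> pg p1 p2 p3; exact: polyf_comp pg (polyf_pair p1 (polyf_pair p2 p3)).
Qed.

Lemma polyf_cons (A B : encType) (a : A -> B) (l : A -> seq B) : polyf a -> polyf l ->
  polyf (fun x => a x :: l x).
Proof.
move=> pa pl; apply: polyf_comp2 pa pl.
exact: (@polyf_cast (prod_encType B (seq_encType B)) (seq_encType B)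
  (fun p : B * seq B => p.1 :: p.2)).
Qed.

Lemma polyf_behead (A B : encType) (l : A -> seq B) : polyf l -> polyf (fun x => behead (l x)).
Proof.
apply: (@polyf_comp A (seq_encType B) (seq_encType B) l behead).
apply: (@polyf_expr _ _ (Tl (Var 0)) (fun a : seq B => esize a + 2)).
  exact: polyb_add polyb_esize (polyb_const _).
by move=> s a sa /=; rewrite sa; split; [case: (a) | rewrite /esize; lia].
Qed.

(** The machine's [Hd] returns [Leaf] on the empty list, so the default has to be the value encoded
    by [Leaf]. *)
Lemma polyf_head (A B : encType) (d : B) (l : A -> seq B) : encode d = Leaf -> polyf l ->
  polyf (fun x => head d (l x)).
Proof.
move=> dL; apply: (@polyf_comp A (seq_encType B) B l (head d)).
apply: (@polyf_expr _ _ (Hd (Var 0)) (fun a : seq B => esize a + 2)).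
  exact: polyb_add polyb_esize (polyb_const _).
by move=> s a sa /=; rewrite sa; split; [case: (a) | rewrite /esize; lia].
Qed.

Lemma polyf_neg (A : encType) (b : A -> bool) : polyf b -> polyf (fun x => ~~ b x).
Proof.
move=> pb; apply: (polyf_ext _ (polyf_if pb (polyf_const A false) (polyf_const A true))).
by move=> x; case: (b x).
Qed.

Lemma polyf_and (A : encType) (b1 b2 : A -> bool) : polyf b1 -> polyf b2 ->
  polyf (fun x => b1 x && b2 x).
Proof. by move=> p1 p2; exact: (polyf_if p1 p2 (polyf_const A false)). Qed.

Lemma polyf_or (A : encType) (b1 b2 : A -> bool) : polyf b1 -> polyf b2 ->
  polyf (fun x => b1 x || b2 x).
Proof. by move=> p1 p2; exact: (polyf_if p1 (polyf_const A true) p2). Qed.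

Lemma polyf_addb (A : encType) (b1 b2 : A -> bool) : polyf b1 -> polyf b2 ->
  polyf (fun x => b1 x (+) b2 x).
Proof.
move=> p1 p2; apply: (polyf_ext _ (polyf_if p1 (polyf_neg p2) p2)).
by move=> x; case: (b1 x).
Qed.

Lemma polyf_fold (A B C : encType) (step : A -> B -> C -> B) (b : A -> B) (l : A -> seq C) :
  polyf (fun p : A * (B * C) => step p.1 p.2.1 p.2.2) -> polyf b -> polyf l ->
  (exists c, forall y b a,
     esize (step y b a) <= esize b + c * (esize y + esize a)) ->
  polyf (fun y => foldl (step y) (b y) (l y)).
Proof.
move=> ps pb pl [c Hc].
apply: (@polyf_foldl _ _ _ _ step id b l) => //; first exact: polyf_id.
exists c.+1 => y b' a; apply: leq_trans (Hc y b' a) _; rewrite leq_add2l.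
apply: leq_mul => //; rewrite -{1}[_ + _]expn1; apply: leq_pexp2l => //.
by rewrite addn_gt0 esize_gt0.
Qed.

Ltac polyf_step :=
  first
  [ exact: polyf_id | exact: polyf_const | exact: polyf_fst | exact: polyf_snd | assumption
  | match goal with
    | |- polyf (fun x => (_, _)) => apply: polyf_pair
    | |- polyf (fun x => if _ then _ else _) => apply: polyf_if
    | |- polyf (fun x => _ (+) _) => apply: polyf_addb
    | |- polyf (fun x => _ && _) => apply: polyf_and
    | |- polyf (fun x => _ || _) => apply: polyf_or
    | |- polyf (fun x => ~~ _) => apply: polyf_neg
    | |- polyf (fun x => _ :: _) => apply: polyf_cons
    | |- polyf (fun x => behead _) => apply: polyf_behead
    | |- polyf (fun x => head _ _) => apply: polyf_head; first by []
    | |- polyf (fun x => _.1) => apply: polyf_fst_comp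
    | |- polyf (fun x => _.2) => apply: polyf_snd_comp
    end ].
Ltac polyf_auto := cbv beta; repeat polyf_step.

Lemma catrev_foldl A (l acc : seq A) : catrev l acc = foldl (fun acc a => a :: acc) acc l.
Proof. by elim: l acc => //= a l IH acc; rewrite IH. Qed.

Lemma polyf_catrev (Y A : encType) (l acc : Y -> seq A) : polyf l -> polyf acc ->
  polyf (fun y => catrev (l y) (acc y)).
Proof.
move=> pl pa.
apply: (polyf_ext (fun y => esym (catrev_foldl (l y) (acc y)))).
apply: (@polyf_fold _ _ _ (fun _ acc a => a :: acc)) => //; first by polyf_auto.
by exists 1 => y b a; rewrite esize_cons; have := esize_gt0 y; lia.
Qed.

Lemma polyf_rev (Y A : encType) (l : Y -> seq A) : polyf l -> polyf (fun y => rev (l y)).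
Proof. by move=> pl; apply: polyf_catrev => //; polyf_auto. Qed.

Lemma polyf_cat (Y A : encType) (l1 l2 : Y -> seq A) : polyf l1 -> polyf l2 ->
  polyf (fun y => l1 y ++ l2 y).
Proof.
move=> p1 p2; apply: (polyf_ext _ (polyf_catrev (polyf_rev p1) p2)).
by move=> y; rewrite catrevE revK.
Qed.

(** A Mealy machine. Operations on two lists become a single pass over one of them, with the other
    carried in the state. *)
Fixpoint mapacc (S A C : Type) (f : S -> A -> S) (g : S -> A -> C) (s : S) (l : seq A) : seq C :=
  if l is a :: l' then g s a :: mapacc f g (f s a) l' else [::].

Lemma polyf_mapacc (Y A C S : encType) (f : Y -> S -> A -> S) (g : Y -> S -> A -> C)
    (s : Y -> S) (l : Y -> seq A) :
  polyf (fun p : Y * (S * A) => f p.1 p.2.1 p.2.2) ->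
  polyf (fun p : Y * (S * A) => g p.1 p.2.1 p.2.2) -> polyf s -> polyf l ->
  (exists c, forall y s a, esize (f y s a) <= esize s + c * (esize y + esize a)) ->
  (exists c, forall y s a, esize (g y s a) <= c * (esize y + esize a) ^ c) ->
  polyf (fun y => mapacc (f y) (g y) (s y) (l y)).
Proof.
move=> pf pg ps pl [c1 H1] [c2 H2].
pose step y (st : S * seq C) a := (f y st.1 a, g y st.1 a :: st.2).
have foldE y st out : (foldl (step y) (st, out) (l y)).2 =
    catrev (mapacc (f y) (g y) st (l y)) out.
  by elim: (l y) st out => //= a l' IH st out; rewrite IH.
apply: (@polyf_ext _ _ (fun y => rev (foldl (step y) (s y, [::]) (l y)).2)).
  by move=> y; rewrite foldE; exact: revK.
apply: polyf_rev; apply: polyf_snd_comp.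
apply: (@polyf_foldl _ _ _ _ step id (fun y => (s y, [::])) l) => //; try by polyf_auto.
  apply: polyf_pair.
    by apply: (polyf_comp3 pf); polyf_auto.
  apply: polyf_cons; last by polyf_auto.
  by apply: (polyf_comp3 pg); polyf_auto.
exists (c1 + c2 + 1) => y [st out] a; rewrite /step !esize_pair esize_cons /=.
have := H1 y st a; have := H2 y st a.
set z := esize y + esize a => h2 h1.
have z1 : 0 < z by rewrite addn_gt0 esize_gt0.
have e1 : z <= z ^ (c1 + c2 + 1) by rewrite -{1}[z]expn1; apply: leq_pexp2l; lia.
have e2 : z ^ c2 <= z ^ (c1 + c2 + 1) by apply: leq_pexp2l; lia.
have {}h1 : esize (f y st a) <= esize st + c1 * z ^ (c1 + c2 + 1).
  by apply: leq_trans h1 _; rewrite leq_add2l leq_mul2l e1 orbT.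
have {}h2 : esize (g y st a) <= c2 * z ^ (c1 + c2 + 1).
  by apply: leq_trans h2 _; rewrite leq_mul2l e2 orbT.
have e3 : 0 < z ^ (c1 + c2 + 1) by rewrite expn_gt0 z1.
by move: (z ^ _) h1 h2 e3 => w; rewrite !mulnDl; lia.
Qed.

Lemma polyf_map (Y A C : encType) (h : Y -> A -> C) (l : Y -> seq A) :
  polyf (fun p : Y * A => h p.1 p.2) -> polyf l ->
  polyf (fun y => [seq h y a | a <- l y]).
Proof.
move=> ph pl.
have mapE y : mapacc (fun (_ : unit) _ => tt) (fun _ => h y) tt (l y) =
    [seq h y a | a <- l y] by elim: (l y) => //= a l' ->.
apply: (polyf_ext mapE).
apply: (@polyf_mapacc Y A C unit_encType (fun _ _ _ => tt) (fun y _ a => h y a)) => //.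
- by polyf_auto.
- by apply: (polyf_comp2 ph); polyf_auto.
- by polyf_auto.
- by exists 0 => y s a; rewrite !esize_unit; lia.
- have [c Hc] := polyf_size ph; exists (c * 2 ^ c) => y _ a.
  apply: leq_trans (Hc (y, a)) _; rewrite esize_pair -mulnA leq_mul2l.
  apply/orP; right; have y0 := esize_gt0 y; have a0 := esize_gt0 a.
  apply: (@leq_trans ((2 * (esize y + esize a)) ^ c)).
    by case: (c) => // c'; rewrite leq_exp2r //; lia.
  rewrite expnMn leq_mul2l; apply/orP; right; apply: leq_pexp2l; first by lia.
  by rewrite leq_pmulr // expn_gt0.
Qed.

(** The list [b] travels as the state and reads as [false] beyond its end; the result always has the
    length of [a]. *)
Definition zipb (op : bool -> bool -> bool) (a b : bitseq) : bitseq :=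
  mapacc (fun st _ => behead st) (fun st x => op x (head false st)) b a.
Definition xors := zipb addb.
Definition ors := zipb orb.

(** For nonzero [r] this is a unit vector whose inner product with [r] is one. It marks the pivot
    column and is also the vector added to repair row [r]. *)
Definition firstone (r : bitseq) : bitseq :=
  mapacc orb (fun found x => ~~ found && x) false r.

Definition dots (a b : bitseq) : bool :=
  (foldl (fun st x => (behead st.1, (x && head false st.1) (+) st.2))
     (b, false) a).2.

Lemma polyf_zipb op (Y : encType) (a b : Y -> bitseq) :
  polyf (fun p : bool * bool => op p.1 p.2) -> polyf a -> polyf b ->
  polyf (fun y => zipb op (a y) (b y)).
Proof.
move=> pop pa pb; apply: (@polyf_mapacc Y bool_encType bool_encType
  (seq_encType bool_encType) (fun _ st _ => behead st)
  (fun _ st x => op x (head false st))) => //.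
- by polyf_auto.
- by apply: (polyf_comp2 pop); polyf_auto.
- by exists 0 => y s x; have := esize_behead s; lia.
- by exists 3 => y s x; have := esize_bool (op x (head false s)); have := esize_gt0 y; nia.
Qed.

Lemma polyf_xors (Y : encType) (a b : Y -> bitseq) :
  polyf a -> polyf b -> polyf (fun y => xors (a y) (b y)).
Proof. by apply: polyf_zipb; polyf_auto. Qed.

Lemma polyf_ors (Y : encType) (a b : Y -> bitseq) :
  polyf a -> polyf b -> polyf (fun y => ors (a y) (b y)).
Proof. by apply: polyf_zipb; polyf_auto. Qed.

Lemma polyf_firstone (Y : encType) (a : Y -> bitseq) :
  polyf a -> polyf (fun y => firstone (a y)).
Proof.
move=> pa; apply: (@polyf_mapacc Y bool_encType bool_encType bool_encType
  (fun _ => orb) (fun _ found x => ~~ found && x)) => //; try by polyf_auto.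
- by exists 3 => y s x; have := esize_bool (s || x); have := esize_gt0 y; lia.
- by exists 3 => y s x; have := esize_bool (~~ s && x); have := esize_gt0 y; nia.
Qed.

Lemma esize_behead_bits (s : bitseq) : esize (behead s) <= esize s.
Proof. exact: esize_behead. Qed.

Lemma polyf_dots (Y : encType) (a b : Y -> bitseq) :
  polyf a -> polyf b -> polyf (fun y => dots (a y) (b y)).
Proof.
move=> pa pb; apply: polyf_snd_comp.
apply: (@polyf_fold Y (prod_encType (seq_encType bool_encType) bool_encType)
  bool_encType (fun _ st x => (behead st.1, (x && head false st.1) (+) st.2))) => //;
  try by polyf_auto.
exists 3 => y [s p] x; rewrite !esize_pair /=.
have := esize_bool ((x && head false s) (+) p); have := esize_behead_bits s.
by have := esize_gt0 y; have := esize_gt0 p; lia.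
Qed.

Lemma polyf_mask (Y A : encType) (m : Y -> bitseq) (l : Y -> seq A) :
  polyf m -> polyf l -> polyf (fun y => mask (m y) (l y)).
Proof.
move=> pm pl.
pose step (st : bitseq * seq A) x :=
  (behead st.1, if head false st.1 then x :: st.2 else st.2).
have foldE s : forall m out, (foldl step (m, out) s).2 = catrev (mask m s) out.
  elim: s => [|x s IH] [|[] m'] out //=; rewrite IH ?mask0s //.
apply: (@polyf_ext _ _ (fun y => rev (foldl step (m y, [::]) (l y)).2)).
  by move=> y; rewrite foldE; exact: revK.
apply: polyf_rev; apply: polyf_snd_comp.
apply: (@polyf_fold Y (prod_encType (seq_encType bool_encType) (seq_encType A))
  A (fun _ => step)) => //; try by rewrite /step; polyf_auto.
exists 1 => y [s out] x; rewrite /step !esize_pair /=; have := esize_behead_bits s.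
by case: (head _ _); rewrite ?esize_cons; have := esize_gt0 y; lia.
Qed.

(** A ripple-carry adder, least significant bit first: when the two bits agree they are the next
    carry, otherwise the carry persists. The list [false :: a ++ b] is a clock long enough for the
    last carry to come out. *)
Definition adds (a b : bitseq) : bitseq :=
  mapacc
    (fun (st : bool * (bitseq * bitseq)) (_ : bool) =>
       let: x := head false st.2.1 in let: y := head false st.2.2 in
       (if x (+) y then st.1 else x, (behead st.2.1, behead st.2.2)))
    (fun (st : bool * (bitseq * bitseq)) (_ : bool) =>
       (head false st.2.1 (+) head false st.2.2) (+) st.1)
    (false, (a, b)) (false :: a ++ b).

(** The least significant bit comes first, so the last differing position overrides all earlier
    ones; the initial [true] settles ties. *)
Definition geqs (a b : bitseq) : bool :=
  (foldl
    (fun (st : bool * (bitseq * bitseq)) (_ : bool) =>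
       let: x := head false st.2.1 in let: y := head false st.2.2 in
       (if x (+) y then x else st.1, (behead st.2.1, behead st.2.2)))
    (true, (a, b)) (a ++ b)).1.

Lemma polyf_adds (Y : encType) (a b : Y -> bitseq) :
  polyf a -> polyf b -> polyf (fun y => adds (a y) (b y)).
Proof.
move=> pa pb.
apply: (@polyf_mapacc Y bool_encType bool_encType
  (prod_encType bool_encType (prod_encType (seq_encType bool_encType) (seq_encType bool_encType)))
  (fun _ st _ => _) (fun _ st _ => _)); try by polyf_auto.
- by apply: polyf_cons; [polyf_auto | apply: polyf_cat].
- exists 3 => y [c [s1 s2]] x; rewrite !esize_pair /=.
  set d := if _ then _ else _.
  have := esize_bool d; have := esize_gt0 c; have := esize_gt0 y.
  by have := esize_behead_bits s1; have := esize_behead_bits s2; lia.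
- exists 3 => y [c [s1 s2]] x /=; set d := _ (+) _.
  by have := esize_bool d; have := esize_gt0 y; nia.
Qed.

Lemma polyf_geqs (Y : encType) (a b : Y -> bitseq) :
  polyf a -> polyf b -> polyf (fun y => geqs (a y) (b y)).
Proof.
move=> pa pb; apply: polyf_fst_comp.
apply: (@polyf_fold Y
  (prod_encType bool_encType (prod_encType (seq_encType bool_encType) (seq_encType bool_encType)))
  bool_encType (fun _ st _ => _)); try by polyf_auto.
- exact: polyf_cat.
- exists 3 => y [c [s1 s2]] x; rewrite !esize_pair /=.
  set d := if _ then _ else _.
  have := esize_bool d; have := esize_gt0 c; have := esize_gt0 y.
  by have := esize_behead_bits s1; have := esize_behead_bits s2; lia.
Qed.

(** * Linear algebra of bit vectors over GF(2) *)

Lemma size_mapacc S A C (f : S -> A -> S) (g : S -> A -> C) s l :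
  size (mapacc f g s l) = size l.
Proof. by elim: l s => //= a l IH s; rewrite IH. Qed.

Lemma size_zipb op a b : size (zipb op a b) = size a.
Proof. exact: size_mapacc. Qed.

Lemma size_firstone r : size (firstone r) = size r.
Proof. exact: size_mapacc. Qed.

Lemma zipb_cons op x a b : zipb op (x :: a) b = op x (head false b) :: zipb op a (behead b).
Proof. by []. Qed.

Lemma xors_cons x a b : xors (x :: a) b = (x (+) head false b) :: xors a (behead b).
Proof. by []. Qed.

Lemma ors_cons x a b : ors (x :: a) b = (x || head false b) :: ors a (behead b).
Proof. by []. Qed.

Lemma nth_zipb op a b i : i < size a ->
  nth false (zipb op a b) i = op (nth false a i) (nth false b i).
Proof.
elim: a b i => // x a IH b [|i] lti; rewrite zipb_cons /= ?nth0 // IH //.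
by rewrite nth_behead.
Qed.

Lemma dots_cons x a b : dots (x :: a) b = (x && head false b) (+) dots a (behead b).
Proof.
have foldE l : forall b p,
    (foldl (fun st x => (behead st.1, (x && head false st.1) (+) st.2)) (b, p) l).2 =
    p (+) dots l b.
  rewrite /dots; elim: l => [|y l IH] {}b p /=; first by rewrite addbF.
  by rewrite IH [in RHS]IH addbF addbCA addbA.
by rewrite /dots /= foldE addbF.
Qed.

Lemma dots_xorsl a c b : size c = size a ->
  dots (xors a c) b = dots a b (+) dots c b.
Proof.
elim: a c b => [|x a IH] [|y c] b //= [sz].
rewrite xors_cons !dots_cons /= IH //; case: (head _ _); rewrite ?andbT ?andbF //.
by case: x y (dots a _) (dots c _) => [] [] [] [].
Qed.

Lemma dots_xorsr a b e : size b = size e ->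
  dots a (xors b e) = dots a b (+) dots a e.
Proof.
elim: a b e => [|x a IH] // [|y b] [|z e] // sz.
  by rewrite addbb; elim: (a) x => [|x' a' IHa] x; rewrite dots_cons andbF // IHa.
rewrite xors_cons !dots_cons /= IH; last by case: sz.
by clear sz; case: x y z (dots a b) (dots a e) => [] [] [] [] [].
Qed.

Lemma dots_nil0 a : dots a [::] = false.
Proof. by elim: a => // x a IH; rewrite dots_cons /= andbF IH. Qed.

Lemma firstone_cons x r :
  firstone (x :: r) = x :: (if x then nseq (size r) false else firstone r).
Proof.
rewrite /firstone /=; case: x => //=; congr cons.
by elim: r => //= a r ->.
Qed.

Lemma dots_nseq0 a k : dots a (nseq k false) = false.
Proof.
by elim: a k => // x a IH [|k]; rewrite dots_cons /= ?dots_nil0 andbF ?IH.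
Qed.

Lemma dots_firstone r : dots r (firstone r) = has id r.
Proof.
elim: r => // x r IH; rewrite firstone_cons dots_cons /= andbb.
by case: x => //=; rewrite dots_nseq0.
Qed.

Lemma firstone_no r : ~~ has id r -> firstone r = nseq (size r) false.
Proof.
elim: r => // x r IH; rewrite firstone_cons /= negb_or => /andP[/negPf-> /IH->] //.
Qed.

Lemma dots_no r z : ~~ has id r -> dots r z = false.
Proof.
elim: r z => // x r IH z; rewrite dots_cons /= negb_or => /andP[/negPf-> /IH->] //.
Qed.

Lemma count_nseq_false k : count id (nseq k false) = 0.
Proof. by rewrite count_nseq. Qed.

Lemma count_firstone r : count id (firstone r) <= 1.
Proof.
by elim: r => // x r IH; rewrite firstone_cons; case: x => //=; rewrite count_nseq_false.
Qed.

Lemma count_ors a b : count id (ors a b) <= count id a + count id b.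
Proof.
elim: a b => // x a IH b; rewrite ors_cons [count _ (_ :: ors _ _)]/=.
have := IH (behead b); rewrite -/(count id _).
by case: b => [|y b] /=; case: x => //=; try case: y => /=; lia.
Qed.

(** * Column bases *)

Definition elim_row (r x : bitseq) : bitseq :=
  if dots x (firstone r) then xors x r else x.

(** One round of Gaussian elimination: the head row contributes its pivot column to the mask and is
    cleared from the later rows at that column. The fold over [rows] makes one round per row. *)
Definition pivot_step (st : bitseq * seq bitseq) (_ : bitseq) : bitseq * seq bitseq :=
  (ors st.1 (firstone (head [::] st.2)),
   [seq elim_row (head [::] st.2) x | x <- behead st.2]).

Definition pivot_mask (v : seq unit) (rows : seq bitseq) : bitseq :=
  (foldl pivot_step ([seq false | _ <- v], rows) rows).1.

Lemma size_elim_row r x : size (elim_row r x) = size x.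
Proof. by rewrite /elim_row; case: ifP => // _; exact: size_zipb. Qed.

(** Induction on the rows. A vector [z1] that agrees with [z] on the eliminated rows is corrected at
    the pivot of [r] so as to agree on [r] too; the eliminated rows vanish at that pivot and do not
    notice. Each original row is an eliminated row, possibly plus [r]. *)
Lemma pivot_spec n (u rows : seq bitseq) (m : bitseq) :
  size u = size rows -> size m = n -> all (fun r => size r == n) rows ->
  let m' := (foldl pivot_step (m, rows) u).1 in
  [/\ size m' = n, (forall i, nth false m i -> nth false m' i),
      count id m' <= count id m + size rows
    & forall z, size z = n -> exists z', [/\ size z' = n,
        forall i, nth false z' i -> nth false m' i
      & forall r, r \in rows -> dots r z' = dots r z]].
Proof.
elim: u rows m => [|u0 u IH] [|r rows] m //= szu szm => [_|/andP[/eqP szr szrows]].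
  split=> //; first by rewrite addn0.
  move=> z szz; exists (nseq n false); split=> //; first by rewrite size_nseq.
  by move=> i; rewrite nth_nseq; case: ifP.
have [] := IH [seq elim_row r x | x <- rows] (ors m (firstone r)) _ _ _ => /=.
- by rewrite size_map; lia.
- by rewrite size_zipb.
- by rewrite all_map; apply: sub_all szrows => x /=; rewrite size_elim_row.
rewrite -/(pivot_step (m, r :: rows) u0); set m' := (foldl _ _ _).1.
move=> szm' sub cnt ex.
have subm i : nth false m i -> nth false m' i.
  move=> mi; apply: sub; rewrite nth_zipb ?mi //.
  by case: (ltnP i (size m)) mi => // le; rewrite nth_default.
have sube i : nth false (firstone r) i -> nth false m' i.
  move=> ei; apply: sub; rewrite nth_zipb ?ei ?orbT // szm -szr -size_firstone.
  by case: (ltnP i (size (firstone r))) ei => // le; rewrite nth_default.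
split=> //.
  apply: leq_trans cnt _; rewrite size_map.
  by have := count_ors m (firstone r); have := count_firstone r; lia.
move=> z szz; have [z1 [sz1 sub1 eq1]] := ex z szz.
have eqx x : x \in rows -> dots (elim_row r x) z1 = dots (elim_row r x) z.
  by move=> xin; apply: eq1; exact: map_f.
have [hr | nhr] := boolP (has id r); last first.
  exists z1; split=> // x; rewrite inE => /orP[/eqP-> | xin].
    by rewrite !dots_no.
  have := eqx x xin; rewrite /elim_row firstone_no // dots_nseq0 //.
(* Adding the pivot unit vector changes the product with [r] by exactly one. *)
pose z2 := if dots r z1 == dots r z then z1 else xors z1 (firstone r).
have sz2 : size z2 = n by rewrite /z2; case: ifP => // _; rewrite size_zipb.
have rz2 : dots r z2 = dots r z.
  rewrite /z2; case: eqP => // ne; rewrite dots_xorsr ?size_firstone ?sz1 //.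
  by rewrite dots_firstone hr; case: (dots r z1) (dots r z) ne => [] [].
exists z2; split=> //.
  move=> i; rewrite /z2; case: ifP => _; first exact: sub1.
  have [lti|le] := ltnP i (size z1); last by rewrite nth_default // size_zipb.
  rewrite nth_zipb //; case h: (nth false z1 i); first by move=> _; exact: sub1.
  by move=> /=; exact: sube.
move=> x; rewrite inE => /orP[/eqP-> // | xin].
have szx : size x = n by apply/eqP; exact: (allP szrows).
have ez2 : dots (elim_row r x) z2 = dots (elim_row r x) z.
  rewrite -eqx // /z2; case: ifP => // _.
  rewrite dots_xorsr ?size_firstone ?sz1 //.
  suff -> : dots (elim_row r x) (firstone r) = false by rewrite addbF.
  rewrite /elim_row; case: ifP => // xr.
  by rewrite dots_xorsl ?xr ?dots_firstone ?hr // szx szr.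
move: ez2; rewrite /elim_row; case: ifP => // _.
rewrite !dots_xorsl ?rz2 ?szx ?szr // .
by case: (dots x z2) (dots x z) (dots r z) => [] [] [].
Qed.

Lemma polyf_elim_row (Y : encType) (r x : Y -> bitseq) :
  polyf r -> polyf x -> polyf (fun y => elim_row (r y) (x y)).
Proof.
move=> pr px; apply: polyf_if => //; last exact: polyf_xors.
by apply: polyf_dots => //; exact: polyf_firstone.
Qed.

Lemma esize_rows (rows : seq bitseq) s : all (fun r => size r <= s) rows ->
  esize rows <= size rows * (4 * s + 2) + 1.
Proof.
elim: rows => //= r rows IH /andP[sr /IH]; rewrite esize_cons.
by have := esize_bits r; lia.
Qed.

Lemma size_row_le (rows : seq bitseq) : all (fun r => size r <= esize rows) rows.
Proof.
apply/allP => r; elim: rows => // r' rows IH; rewrite inE esize_cons => /orP[/eqP->|/IH].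
  by have : size r' < esize r' := size_le_esize r'; lia.
by lia.
Qed.

(** Each round rewrites all remaining rows, so an additive growth bound is out of reach; instead
    neither the number nor the length of the rows ever increases. *)
Lemma pivot_step_inv (u rows : seq bitseq) (m : bitseq) s :
  all (fun r => size r <= s) rows ->
  let st := foldl pivot_step (m, rows) u in
  [/\ size st.1 = size m, size st.2 <= size rows & all (fun r => size r <= s) st.2].
Proof.
elim: u m rows => [|u0 u IH] m rows //= ar.
have [] := IH (ors m (firstone (head [::] rows)))
  [seq elim_row (head [::] rows) x | x <- behead rows] => /=.
  case: rows ar => //= r rows /andP[_ ar]; rewrite all_map.
  by apply: sub_all ar => x /=; rewrite size_elim_row.
rewrite size_zipb size_map => -> le ->; split=> //; apply: leq_trans le _.
by case: (rows).
Qed.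

Lemma polyf_pivot_mask (Y : encType) (v : Y -> seq unit) (rows : Y -> seq bitseq) :
  polyf v -> polyf rows -> polyf (fun y => pivot_mask (v y) (rows y)).
Proof.
move=> pv pr; apply: polyf_fst_comp.
have pm : polyf (fun y => [seq false | _ <- v y]).
  by apply: (@polyf_map _ unit_encType bool_encType (fun _ _ => false)) => //; polyf_auto.
apply: (@polyf_foldl_bounded Y
  (prod_encType (seq_encType bool_encType) (seq_encType (seq_encType bool_encType)))
  (seq_encType bool_encType) Y
  (fun _ => pivot_step) id (fun y => ([seq false | _ <- v y], rows y)) rows) => //.
- apply: polyf_pair.
    apply: polyf_ors; first by polyf_auto.
    by apply: polyf_firstone; polyf_auto.
  apply: (@polyf_map _ (seq_encType bool_encType) (seq_encType bool_encType)
    (fun p x => elim_row (head [::] p.2.1.2) x)); last by polyf_auto.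
  by apply: polyf_elim_row; polyf_auto.
- exact: polyf_id.
- by polyf_auto.
have sv := polyf_size pv; have sr := polyf_size pr.
exists (fun y => (4 * esize (v y) + 1) + (esize (rows y) * (4 * esize (rows y) + 2) + 1) + 1).
  apply: polyb_add (polyb_const _); apply: polyb_add; apply: polyb_add (polyb_const _).
    exact: polyb_mul (polyb_const _) sv.
  apply: polyb_mul => //; apply: polyb_add (polyb_const _).
  exact: polyb_mul (polyb_const _) sr.
move=> y i; have := @pivot_step_inv (take i (rows y)) (rows y) [seq false | _ <- v y]
  (esize (rows y)) (size_row_le _).
case: (foldl _ _ _) => m r /= [szm szr ar].
rewrite esize_pair; have := esize_bits m; have := esize_rows ar.
rewrite szm size_map.
have h1 : size (v y) < esize (v y) := size_le_esize (v y).
have h2 : size (rows y) < esize (rows y) := size_le_esize (rows y).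
have h3 : size r * (4 * esize (rows y) + 2) <= esize (rows y) * (4 * esize (rows y) + 2).
  by rewrite leq_mul2r (leq_trans szr (ltnW h2)) orbT.
by move: h3 h1; clear; move: (size r * _) (esize (rows y) * _); lia.
Qed.

(** * Binary arithmetic *)

Definition bval (l : bitseq) : nat := foldr (fun (b : bool) v => b + 2 * v) 0 l.

Lemma bval_cons b l : bval (b :: l) = b + 2 * bval l. Proof. by []. Qed.

Lemma bval_head l : bval l = head false l + 2 * bval (behead l).
Proof. by case: l. Qed.

Lemma bval_lt l : bval l < 2 ^ size l.
Proof. by elim: l => // b l IH; rewrite bval_cons /= expnS; case: b; lia. Qed.

Lemma bval_adds a b : bval (adds a b) = bval a + bval b.
Proof.
rewrite /adds; set f := (X in mapacc X _ _ _); set g := (X in mapacc _ X _ _).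
(* Invariant: the carry and the remaining numerals sum to a value that fits into the bits still to
   be produced. *)
have H u : forall c a b, (c : bool) + (bval a + bval b) < 2 ^ size u ->
    bval (mapacc f g (c, (a, b)) u) = c + (bval a + bval b).
  elim: u => [|x u IH] c {}a {}b; first by rewrite expn0 /=; lia.
  rewrite /= expnS => lt; rewrite IH.
    rewrite (bval_head a) (bval_head b) /g /=.
    by case: c (head _ a) (head _ b) {lt} => [] [] [] /=; lia.
  by move: lt; rewrite (bval_head a) (bval_head b) /=;
    case: c (head _ a) (head _ b) => [] [] [] /=; lia.
rewrite H // /= size_cat expnS expnD; have := bval_lt a; have := bval_lt b.
by move: (2 ^ _) (2 ^ _) => x y ? ?; nia.
Qed.

Lemma geqsE a b : geqs a b = (bval b <= bval a).
Proof.
rewrite /geqs; set f := (X in foldl X _ _).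
(* Here [c] is the verdict on the lower bits already consumed; it stands only if the remaining
   higher parts are equal. *)
have H u : forall c a b, (bval a < 2 ^ size u) && (bval b < 2 ^ size u) ->
   (foldl f (c, (a, b)) u).1 = if bval a == bval b then c else bval b < bval a.
  elim: u => [|x u IH] c {}a {}b.
    by rewrite expn0 !ltnS !leqn0 => /andP[/eqP-> /eqP->].
  rewrite /= expnS => /andP[la lb]; rewrite IH /=.
    rewrite (bval_head a) (bval_head b).
    by case: c (head _ a) (head _ b) {la lb} => [] [] [] /=; do !case: eqP; lia.
  by move: la lb; rewrite (bval_head a) (bval_head b); lia.
rewrite H; first by case: ltngtP.
apply/andP; split; apply: leq_trans (bval_lt _) _; apply: leq_pexp2l => //;
by rewrite size_cat ?leq_addr ?leq_addl.
Qed.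

Definition bits (n : nat) : bitseq := [seq odd (n %/ 2 ^ i) | i <- iota 0 (up_log 2 n.+1)].

Lemma encode_bits n : encode (bits n) = enc_nat n.
Proof. by rewrite /= -map_comp. Qed.

Lemma size_bits n : size (bits n) = up_log 2 n.+1.
Proof. by rewrite size_map size_iota. Qed.

Lemma bval_bits n : bval (bits n) = n.
Proof.
have H L m : m < 2 ^ L -> bval [seq odd (m %/ 2 ^ i) | i <- iota 0 L] = m.
  elim: L m => [|L IH] m lt; first by move: lt; rewrite expn0; case: m.
  rewrite /= expn0 divn1 (iotaDl 1 0) -map_comp.
  rewrite (eq_map (g := fun i => odd (m %/ 2 %/ 2 ^ i))); last first.
    by move=> i; rewrite /= add1n expnS divnMA.
  by rewrite IH; move: lt; rewrite expnS; lia.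
by apply: H; apply: up_logP.
Qed.

(** * The kernelization map *)

Definition half_list (u : seq unit) : seq unit :=
  (foldl (fun (st : bool * seq unit) (_ : unit) =>
     if st.1 then (false, tt :: st.2) else (true, st.2)) (false, [::]) u).2.

Lemma size_half_list u : size (half_list u) = (size u) %/ 2.
Proof.
rewrite /half_list.
suff H c out : size (foldl (fun (st : bool * seq unit) (_ : unit) =>
     if st.1 then (false, tt :: st.2) else (true, st.2)) (c, out) u).2 =
  (c + size u) %/ 2 + size out by rewrite H addn0.
by elim: u c out => [|x u IH] [] out //=; rewrite IH /=; lia.
Qed.

Lemma esize_units (u : seq unit) : esize u = 2 * size u + 1.
Proof. by elim: u => //= x u IH; rewrite esize_cons esize_unit IH; lia. Qed.

Lemma polyf_half_list (Y : encType) (u : Y -> seq unit) :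
  polyf u -> polyf (fun y => half_list (u y)).
Proof.
move=> pu; apply: polyf_snd_comp.
apply: (@polyf_fold Y (prod_encType bool_encType (seq_encType unit_encType)) unit_encType
  (fun _ st _ => if st.1 then (false, tt :: st.2) else (true, st.2))) => //; try by polyf_auto.
exists 3 => y [[] out] x; rewrite /= !esize_pair ?esize_cons.
  by have := esize_gt0 y; have -> : esize tt = 1 by []; have -> : esize false = 1 by []; lia.
have -> : esize true = 3 by []. 
by have := esize_gt0 y; lia.
Qed.

Definition eqn : Type := bitseq * (bool * bitseq).
Definition inst : Type := seq unit * (seq eqn * bitseq).
Definition eqn_encType : encType :=
  prod_encType (seq_encType bool_encType) (prod_encType bool_encType (seq_encType bool_encType)).
Definition inst_encType : encType :=
  prod_encType (seq_encType unit_encType)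
    (prod_encType (seq_encType eqn_encType) (seq_encType bool_encType)).

(* Decides C.+1 * 4 ^ size i.2.2 <= size i.2.1 by repeated quartering; k itself may be
   exponential in the input size. *)
Definition many_eqns (C : nat) (i : inst) : bool :=
  ~~ nilp (iter C behead (foldl (fun u (_ : bool) => half_list (half_list u))
    [seq tt | _ <- i.2.1] i.2.2)).

(** Something is left after dropping [C] units exactly when the quotient of the number of equations
    by [4 ^ size i.2.2] is at least [C.+1]. *)
Lemma many_eqnsE C i : many_eqns C i = (C.+1 * 4 ^ size i.2.2 <= size i.2.1).
Proof.
rewrite /many_eqns /nilp.
have -> n (s : seq unit) : size (iter n behead s) = size s - n.
  by elim: n s => [|n IH] s; rewrite ?subn0 //= size_behead IH; lia.
have -> (u : seq unit) (l : bitseq) :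
  size (foldl (fun u (_ : bool) => half_list (half_list u)) u l) = size u %/ 4 ^ size l.
  elim: l u => [|b l IH] u /=; first by rewrite divn1.
  by rewrite IH !size_half_list -!divnMA expnS mulnA.
by rewrite size_map subn_eq0 -ltnNge leq_divRL // expn_gt0.
Qed.

Lemma polyf_many_eqns C : @polyf inst_encType bool_encType (many_eqns C).
Proof.
apply: polyf_neg.
pose w (i : inst) := foldl (fun u (_ : bool) => half_list (half_list u))
  [seq tt | _ <- i.2.1] i.2.2.
have pw : @polyf inst_encType (seq_encType unit_encType) w.
  apply: (@polyf_fold inst_encType (seq_encType unit_encType) bool_encType
    (fun _ u _ => half_list (half_list u)) (fun i => [seq tt | _ <- i.2.1])).
  - by apply: polyf_half_list; apply: polyf_half_list; polyf_auto.
  - apply: (@polyf_map inst_encType eqn_encType unit_encType (fun _ _ => tt)); by polyf_auto.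
  - by polyf_auto.
  - exists 0 => y u x; rewrite !esize_units !size_half_list; lia.
have piter : @polyf inst_encType (seq_encType unit_encType) (fun i => iter C behead (w i)).
  by elim: C => // C IH; exact: polyf_behead.
have pnil : @polyf (seq_encType unit_encType) bool_encType (fun u : seq unit => nilp u).
  apply: (@polyf_ext _ _ (fun u : seq unit => foldl (fun _ _ => false) true u)).
    by case=> // x u /=; elim: u.
  apply: (@polyf_fold (seq_encType unit_encType) bool_encType unit_encType (fun _ _ _ => false));
    try by polyf_auto.
  by exists 3 => y b a; have := esize_gt0 y; have -> : esize false = 1 by []; lia.
exact: polyf_comp pnil piter.
Qed.

Definition instance_mask (i : inst) : bitseq := pivot_mask i.1 [seq e.1 | e <- i.2.1].

Definition kernel (C : nat) (yes : inst) (i : inst) : inst :=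
  if many_eqns C i then yes
  else (mask (instance_mask i) i.1,
        ([seq (mask (instance_mask i) e.1, e.2) | e <- i.2.1], i.2.2)).

Lemma polyf_kernel C yes : @polyf inst_encType inst_encType (kernel C yes).
Proof.
have pm : @polyf inst_encType (seq_encType bool_encType) instance_mask.
  apply: polyf_pivot_mask; first by polyf_auto.
  by apply: (@polyf_map inst_encType eqn_encType (seq_encType bool_encType)
    (fun _ e => e.1)); polyf_auto.
apply: polyf_if; first exact: polyf_many_eqns.
  exact: polyf_const.
apply: polyf_pair; first by apply: polyf_mask => //; polyf_auto.
apply: polyf_pair; last by polyf_auto.
apply: (@polyf_map inst_encType eqn_encType eqn_encType
  (fun i e => (mask (instance_mask i) e.1, e.2))); last by polyf_auto.
apply: polyf_pair; last by polyf_auto.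
apply: polyf_mask; last by polyf_auto.
by apply: (polyf_comp pm); polyf_auto.
Qed.

(** * Exhaustive search *)

Definition tally_step (z : bitseq) (st : bitseq * bitseq) (e : eqn) : bitseq * bitseq :=
  if dots e.1 z (+) e.2.1 then (st.1, adds st.2 e.2.2) else (adds st.1 e.2.2, st.2).

(** [false :: k] denotes 2k, so the test is sat >= falsified + 2k, the integral form of sat >= W/2 +
    k. *)
Definition check (p : inst * bitseq) : bool :=
  let: st := foldl (tally_step p.2) ([::], false :: p.1.2.2) p.1.2.1 in geqs st.1 st.2.

(** Each addition widens one tally by the width of the weight plus one, which the encoding of the
    equation pays for. The tallies thus stay linear in the input. *)
Lemma size_tally z st l :
  size (foldl (tally_step z) st l).1 + size (foldl (tally_step z) st l).2 <=
  size st.1 + size st.2 + @esize (seq_encType eqn_encType) l.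
Proof.
elim: l st => [|e l IH] st /=; first by lia.
apply: leq_trans (IH _) _; rewrite esize_cons.
have h : size e.2.2 + 1 <= @esize eqn_encType e.
  case: e => a [b w] /=; rewrite !esize_pair.
  by have : size w < esize w := size_le_esize w; lia.
have sa a b : size (adds a b) = (size a + size b).+1.
  by rewrite size_mapacc /= size_cat.
by rewrite /tally_step; case: ifP => _; cbn [fst snd]; rewrite sa; lia.
Qed.

Lemma polyf_check :
  @polyf (prod_encType inst_encType (seq_encType bool_encType)) bool_encType check.
Proof.
pose Y := prod_encType inst_encType (seq_encType bool_encType).
pose w (p : Y) := foldl (tally_step p.2) ([::], false :: p.1.2.2) p.1.2.1.
suff pw : @polyf Y (prod_encType (seq_encType bool_encType) (seq_encType bool_encType)) w.
  by apply: polyf_geqs; [exact: polyf_fst_comp pw | exact: polyf_snd_comp pw].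
have pl : @polyf Y (seq_encType eqn_encType) (fun p => p.1.2.1) by polyf_auto.
apply: (@polyf_foldl_bounded Y
  (prod_encType (seq_encType bool_encType) (seq_encType bool_encType)) eqn_encType Y
  (fun p => tally_step p.2) id (fun p => ([::], false :: p.1.2.2)) (fun p => p.1.2.1)).
- apply: polyf_if.
  + apply: polyf_addb; last by polyf_auto.
    by apply: polyf_dots; polyf_auto.
  + by apply: polyf_pair; [polyf_auto | apply: polyf_adds; polyf_auto].
  + by apply: polyf_pair; [apply: polyf_adds; polyf_auto | polyf_auto].
- exact: polyf_id.
- by polyf_auto.
- exact: pl.
- exists (fun p => 20 * @esize Y p + 20).
    exact: polyb_add (polyb_mul (polyb_const _) polyb_esize) (polyb_const _).
  move=> [[v [eqs k]] z] i /=.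
  have := size_tally z ([::], false :: k) (take i eqs).
  have := @esize_take eqn_encType eqs i.
  case: (foldl _ _ _) => a b /=; rewrite !esize_pair => le1 le2.
  have := esize_bits a; have := esize_bits b.
  have : size k < esize k := size_le_esize k.
  move: le1 le2; rewrite /inst_encType /= ; lia.
Qed.

Definition double_all (acc : seq bitseq) : seq bitseq :=
  foldl (fun out v => (false :: v) :: (true :: v) :: out) [::] acc.

Definition alls (v : seq unit) : seq bitseq :=
  foldl (fun acc (_ : unit) => double_all acc) [:: [::]] v.

Definition search (i : inst) : bool := has (fun z => check (i, z)) (alls i.1).

Lemma mem_double_all acc b v : v \in acc -> b :: v \in double_all acc.
Proof.
rewrite /double_all => vin.
have mono l out x : x \in out ->
    x \in foldl (fun out v => (false :: v) :: (true :: v) :: out) out l.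
  by elim: l out => //= a l IH out xin; apply: IH; rewrite !inE xin !orbT.
elim: acc [::] vin => // a l IH out; rewrite inE => /orP[/eqP->|vin] /=; last exact: IH.
by apply: mono; rewrite !inE; case: (b); rewrite eqxx ?orbT.
Qed.

Lemma mem_alls v z : size z = size v -> z \in alls v.
Proof.
elim/last_ind: v z => [|v u IH] z; first by case: z.
rewrite size_rcons /alls -cats1 foldl_cat /= -/(alls v).
by case: z => // b z [sz]; apply: mem_double_all; exact: IH.
Qed.

Lemma esize_double_all acc : esize (double_all acc) <= 10 * esize acc.
Proof.
rewrite /double_all.
suff H out : esize (foldl (fun out v => (false :: v) :: (true :: v) :: out) out acc) + 1 <=
    10 * esize acc + esize out by have := H [::]; rewrite esize_nil; lia.
elim: acc out => [|a l IH] out /=; first by rewrite esize_nil; lia.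
apply: leq_trans (IH _) _; rewrite !esize_cons.
have -> : esize false = 1 by []. have -> : esize true = 3 by [].
by have := esize_gt0 a; lia.
Qed.

Lemma esize_alls v i : esize (foldl (fun acc (_ : unit) => double_all acc)
  ([:: [::]] : seq bitseq) (take i v)) <= 3 * 10 ^ size v.
Proof.
rewrite -{2}(cat_take_drop i v) size_cat expnD mulnA.
apply: leq_trans (leq_pmulr _ _); last by rewrite expn_gt0.
elim/last_ind: (take i v) => [|l u IH]; first by [].
rewrite size_rcons -cats1 foldl_cat expnS /=.
by apply: leq_trans (esize_double_all _) _; lia.
Qed.

Lemma polyf_double_all (Y : encType) (l : Y -> seq bitseq) :
  polyf l -> polyf (fun y => double_all (l y)).
Proof.
move=> pl; apply: (@polyf_fold Y (seq_encType (seq_encType bool_encType)) (seq_encType bool_encType)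
  (fun _ out v => (false :: v) :: (true :: v) :: out)) => //; try by polyf_auto.
exists 10 => y out v; rewrite !esize_cons.
have -> : esize false = 1 by []. have -> : esize true = 3 by [].
by have := esize_gt0 y; have := esize_gt0 v; lia.
Qed.

Lemma expn_mono m n c : m <= n -> m ^ c <= n ^ c.
Proof. by case: c => // c; rewrite leq_exp2r. Qed.

(** Listing all assignments takes time polynomial in the input size and the bound on the list, which
    is exponential only in the number of variables; testing the list is polynomial in its size. *)
Lemma search_time : exists P n c,
  @computes inst_encType bool_encType P n
    (fun i => c * (10 ^ size i.1 * @esize inst_encType i) ^ c) search.
Proof.
pose I := inst_encType; pose L := seq_encType (seq_encType bool_encType).
have [P1 [n1 [c1 H1]]] := @foldl_time I L unit_encType I
  (fun _ acc _ => double_all acc) id (fun=> [:: [::]]) (fun i => i.1)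
  ltac:(by apply: polyf_double_all; polyf_auto) (polyf_id _)
  ltac:(by polyf_auto) ltac:(by polyf_auto).
have {}H1 := H1 (fun i => 3 * 10 ^ size i.1) (fun i j => esize_alls i.1 j).
have [P2 [n2 [T2 [[c2 H2] cid]]]] := polyf_id I.
have phas : @polyf (prod_encType I L) bool_encType
    (fun p => has (fun z => check (p.1, z)) p.2).
  apply: (@polyf_ext _ _ (fun p : I * seq bitseq =>
     foldl (fun b z => b || check (p.1, z)) false p.2)).
    move=> [i l] /=.
    suff H b : foldl (fun b z => b || check (i, z)) b l = b || has (fun z => check (i, z)) l.
      exact: H.
    by elim: l b => [|z l IH] b /=; rewrite ?orbF // IH orbA.
  apply: (@polyf_fold (prod_encType I L) bool_encType (seq_encType bool_encType)
    (fun p b z => b || check (p.1, z))); try by polyf_auto.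
    apply: polyf_or; first by polyf_auto.
    by apply: (polyf_comp polyf_check); polyf_auto.
  by exists 3 => y b a; have := esize_bool (b || check (y.1, a)); have := esize_gt0 y; lia.
case: phas => [P3 [n3 [T3 [[c3 H3] chas]]]].
have Hc := computes_comp (computes_pair cid H1) chas.
pose c := c2 + c1 * 4 ^ c1 + c3 * 5 ^ c3 + 50.
do 2 eexists; exists c; case: Hc => n0 Hc; split; first exact: n0.
move=> s i si; have [t [s' [h1 h2 h3 h4]]] := Hc s i si.
exists t, s'; split=> //; first exact: h1.
apply: leq_trans h4 _.
have eA : esize (alls i.1) <= 3 * 10 ^ size i.1.
  by have := esize_alls i.1 (size i.1); rewrite take_size.
have e10 : 0 < 10 ^ size i.1 by rewrite expn_gt0.
have ei := @esize_gt0 I i.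
have t2 := H2 i; have t3 := H3 (i, alls i.1); rewrite esize_pair in t3.
rewrite -/(alls i.1).
move: {+}(@esize I i) (esize (alls i.1)) (10 ^ size i.1) (T2 i) (T3 (i, alls i.1)) ei eA e10 t2 t3.
move=> x y w v2 v3 ei eA e10 t2 t3; set Z := w * x.
have Z0 : 0 < Z by rewrite muln_gt0 e10 ei.
have [xZ wZ] : x <= Z /\ w <= Z by rewrite leq_pmull // leq_pmulr.
have up K p q : q <= K * Z ^ p -> p <= c -> q <= K * Z ^ c.
  by move=> le pc; apply: leq_trans le _; rewrite leq_mul2l leq_pexp2l ?orbT.
have {}t2 : v2 <= c2 * Z ^ c.
  apply: (up _ c2); last by rewrite /c; lia.
  by apply: leq_trans t2 _; rewrite leq_mul2l expn_mono ?orbT.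
have cle a k : 0 < k -> a <= a * k ^ a by move=> k0; rewrite leq_pmulr // expn_gt0 k0.
have t1 : c1 * (x + 3 * w) ^ c1 <= (c1 * 4 ^ c1) * Z ^ c.
  apply: (up _ c1); last by have := @cle c1 4 isT; rewrite /c; lia.
  rewrite -mulnA -expnMn leq_mul2l expn_mono ?orbT //; lia.
have {}t3 : v3 <= (c3 * 5 ^ c3) * Z ^ c.
  apply: (up _ c3); last by have := @cle c3 5 isT; rewrite /c; lia.
  apply: leq_trans t3 _; rewrite -mulnA -expnMn leq_mul2l expn_mono ?orbT //; lia.
have t4 : 2 * (x + x + y) <= 10 * Z ^ c.
  by apply: (up _ 1); rewrite ?expn1 /c; lia.
have t5 : 0 < Z ^ c by rewrite expn_gt0 Z0.
rewrite {1}/c !mulnDl; move: (Z ^ c) t1 t2 t3 t4 t5 => q; lia.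
Qed.

(** * Computability of the parameter-dependent factor *)

Lemma polyf_units_quad (Y : encType) (u : Y -> seq unit) :
  polyf u -> polyf (fun y => u y ++ u y ++ u y ++ u y).
Proof. by move=> pu; do 3!(apply: polyf_cat => //). Qed.

Lemma bits_exp2 N : bits (2 ^ N) = rcons (nseq N false) true.
Proof.
have sz : up_log 2 (2 ^ N).+1 = N.+1.
  by apply: up_log_eq => //; rewrite ?ltnS // leqnn /= expnS; have := expn_gt0 2 N; lia.
apply: (@eq_from_nth _ false); first by rewrite size_bits sz size_rcons size_nseq.
move=> i; rewrite size_bits sz ltnS => le.
rewrite (nth_map 0) ?size_iota ?sz // nth_iota // add0n nth_rcons size_nseq nth_nseq.
case: ltngtP le => // [lt _|-> _]; last by rewrite divnn expn_gt0.
rewrite -(subnK (ltnW lt)) expnD mulnK ?expn_gt0 // oddX.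
by case: (N - i) (subn_gt0 i N) => //; rewrite lt.
Qed.

(** A power of two is written as a run of zeros followed by a one. The length of the run is built in
    unary, by quadrupling a list once per bit of k, so no multiplication of numerals is required. *)
Lemma computable_exp2_exp4 D : computable (fun k => 2 ^ (D * 4 ^ up_log 2 k.+1)).
Proof.
pose B := seq_encType bool_encType; pose V := seq_encType unit_encType.
pose w (l : bitseq) := foldl (fun u (_ : bool) => u ++ u ++ u ++ u) (nseq D tt) l.
have szw l : size (w l) = D * 4 ^ size l.
  rewrite /w; elim/last_ind: l => [|l b IH]; first by rewrite size_nseq muln1.
  by rewrite -cats1 foldl_cat /= !size_cat IH /= addn1 expnS; lia.
have bd l i : esize (w (take i l)) <= 2 * (D * 4 ^ size l) + 1.
  rewrite esize_units szw leq_add2r leq_mul2l /= leq_mul2l.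
  by rewrite leq_pexp2l ?orbT // size_take_min geq_minr.
have [P1 [n1 [c1 H1]]] := @foldl_time B V bool_encType B
  (fun _ u _ => u ++ u ++ u ++ u) id (fun=> nseq D tt) id
  ltac:(by apply: polyf_units_quad; polyf_auto) (polyf_id _)
  ltac:(by polyf_auto) (polyf_id _).
have {}H1 : computes P1 n1 _ w := H1 (fun l => 2 * (D * 4 ^ size l) + 1) bd.
have pg : @polyf V B (fun u => foldl (fun out (_ : unit) => false :: out) [:: true] u).
  apply: (@polyf_fold V B unit_encType (fun _ out _ => false :: out)); try by polyf_auto.
  exists 2 => y out x; rewrite esize_cons; have -> : esize false = 1 by [].
  by have := esize_gt0 y; rewrite /B; lia.
case: pg => [P2 [n2 [T2 [_ H2]]]].
have [_ H] := computes_comp H1 H2.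
exists (Seq P1 P2) => k.
have [|t [s' [ex s0 _ _]]] := H (update (fun=> Leaf) 0 (enc_nat k)) (bits k).
  by rewrite updateE encode_bits.
exists t, s' => //; rewrite s0 -encode_bits bits_exp2 -size_bits -szw.
congr encode; elim/last_ind: (w (bits k)) => // u x IH.
by rewrite -cats1 foldl_cat /= IH size_cat addn1.
Qed.

(** * Systems as encoded data, and correctness of the search *)

Definition instance_of (S : system) (k : nat) : inst :=
  (nseq (nvar S) tt,
   ([seq ([seq i \in vars j | i <- enum 'I_(nvar S)], (rhs j != 0%R, bits (weight j)))
     | j <- enum 'I_(neqn S)], bits k)).

Lemma encode_instance S k : @encode inst_encType (instance_of S k) = enc_instance S k.
Proof.
rewrite /enc_instance /instance_of /= -[in LHS]map_comp.
congr (Node (enc_list _) (Node (enc_list _) _)).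
- by rewrite map_nseq.
- by apply: eq_map => j; rewrite /= /enc_eqn -encode_bits -map_comp.
- by rewrite -encode_bits /= -map_comp.
Qed.

Definition toF (b : bool) : 'F_2 := (b%:R)%R.

Lemma toF_addb x y : toF (x (+) y) = (toF x + toF y)%R.
Proof. by case: x y => [] []; apply/eqP. Qed.

Lemma toF_inj : injective toF.
Proof. by case=> [] []. Qed.

Lemma toF_neq0 (x : 'F_2) : toF (x != 0%R) = x.
Proof. by case: x => [] [|[|m]] // i; apply/eqP. Qed.

Lemma dots_big a b :
  dots a b = \big[addb/false]_(i < size a) (nth false a i && nth false b i).
Proof.
elim: a b => [|x a IH] b; first by rewrite big_ord0.
rewrite dots_cons IH /= big_ord_recl /= nth0; congr addb.
by apply: eq_bigr => i _; rewrite nth_behead.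
Qed.

Definition row (S : system) (j : 'I_(neqn S)) : bitseq :=
  [seq i \in vars j | i <- enum 'I_(nvar S)].

Lemma size_row (S : system) (j : 'I_(neqn S)) : size (row j) = nvar S.
Proof. by rewrite size_map size_enum_ord. Qed.

Lemma nth_map_enum n (f : 'I_n -> bool) (i : 'I_n) :
  nth false [seq f i | i <- enum 'I_n] i = f i.
Proof. by rewrite (nth_map i) ?size_enum_ord // nth_ord_enum. Qed.

Lemma toF_dots_row (S : system) (j : 'I_(neqn S)) z :
  toF (dots (row j) z) = (\sum_(i in vars j) toF (nth false z i))%R.
Proof.
rewrite dots_big (big_morph toF toF_addb (erefl _)) size_row.
rewrite [RHS]big_mkcond /=; apply: eq_bigr => i _; rewrite nth_map_enum.
by case: ifP.
Qed.

Lemma linalb_nat S (k : nat) (z : 'I_(nvar S) -> 'F_2) :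
  ((total_weight S)%:R / 2 + k%:R <= (sat_weight z)%:R :> rat)%R =
  (2 * k + \sum_(j < neqn S | ~~ satisfies z j) weight j <= sat_weight z).
Proof.
have -> : total_weight S = sat_weight z + \sum_(j < neqn S | ~~ satisfies z j) weight j.
  by rewrite /total_weight (bigID (satisfies z)).
rewrite -(ler_nat rat) [in RHS]natrD natrM [in LHS]natrD; move: (_%:R)%R (_%:R)%R (k%:R)%R => x y w.
by apply/idP/idP; lra.
Qed.

Lemma satisfies_dots (S : system) (j : 'I_(neqn S)) z :
  satisfies (fun i => toF (nth false z i)) j = ~~ (dots (row j) z (+) (rhs j != 0%R)).
Proof.
rewrite /satisfies -toF_dots_row -{1}(toF_neq0 (rhs j)) (inj_eq toF_inj).
by case: (dots _ _) (_ != _) => [] [].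
Qed.

Lemma bval_tally (S : system) z (l : seq 'I_(neqn S)) st :
  let st' := foldl (tally_step z) st
    [seq (row j, (rhs j != 0%R, bits (weight j))) | j <- l] in
  let sat := @satisfies S (fun i => toF (nth false z i)) in
  bval st'.1 = bval st.1 + \sum_(j <- l | sat j) weight j /\
  bval st'.2 = bval st.2 + \sum_(j <- l | ~~ sat j) weight j.
Proof.
elim: l st => [|j l IH] st /=; first by rewrite !big_nil !addn0.
have [-> ->] := IH (tally_step z st (row j, (rhs j != 0%R, bits (weight j)))).
rewrite !big_cons satisfies_dots /tally_step negbK; cbn [fst snd].
by case: ifP => _; cbn [fst snd]; rewrite bval_adds bval_bits addnA.
Qed.

Lemma checkE (S : system) k z :
  check (instance_of S k, z) =
  ((total_weight S)%:R / 2 + k%:R <=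
   (sat_weight (fun i : 'I_(nvar S) => toF (nth false z i)))%:R :> rat)%R.
Proof.
rewrite linalb_nat /check geqsE; cbn [fst snd].
have [-> ->] := bval_tally z (enum 'I_(neqn S)) ([::], false :: bits k).
by cbn [fst snd]; rewrite bval_cons bval_bits !big_enum_cond.
Qed.

Lemma sat_weight_ext S (z z' : 'I_(nvar S) -> 'F_2) :
  (forall j : 'I_(neqn S), \sum_(i in vars j) z i = \sum_(i in vars j) z' i)%R ->
  sat_weight z = sat_weight z'.
Proof. by move=> H; apply: eq_bigl => j; rewrite /satisfies H. Qed.

Lemma searchP S k : search (instance_of S k) <-> linalb S k.
Proof.
split; first by case/hasP => z _; rewrite checkE; exists (fun i => toF (nth false z i)).
case=> z Hz; apply/hasP; exists [seq z i != 0%R | i <- enum 'I_(nvar S)].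
  by apply: mem_alls; rewrite size_map size_enum_ord size_nseq.
rewrite checkE; congr (is_true (_ <= _)%R): Hz; congr (_%:R)%R.
by apply: sat_weight_ext => j; apply: eq_bigr => i _; rewrite nth_map_enum toF_neq0.
Qed.

(** * Fixed-parameter tractability from a quadratic kernel *)

Lemma fpt_of_kernel (C : system -> Prop) : quadratic_kernel_on C -> fpt_on C.
Proof.
move=> [P [c [d HK]]]; have [Q [n [e [n0 HQ]]]] := search_time.
(* [D] absorbs the exponential factor: 10 <= 2^4, and the kernel has at most [d * k ^ 2] variables.
   [G] exceeds all coefficients and exponents of the polynomial part; inputs have size x >= 2, so
   the coefficient satisfies G <= x^G and is traded for a second [G] in the exponent. *)
pose D := 4 * d * e; pose G := c + e * (c + 1) ^ e + 2 + (c + 1) * e.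
exists (Seq P Q), (fun k => 2 ^ (D * 4 ^ up_log 2 k.+1)), (G + G).
split; first exact: computable_exp2_exp4.
move=> S k rS CS k0.
have [t1 [S' [k' [[s ex s0] tP [rS' CS' k'k] eqv [mS' nS']]]]] := HK S k rS CS k0.
have si : s 0 = @encode inst_encType (instance_of S' k') by rewrite encode_instance.
have [t2 [s' [ex2 s'0 _ tQ]]] := HQ s _ si.
exists (t1 + t2).+1, (search (instance_of S' k')); split; last by rewrite searchP eqv.
  by exists s' => //; exact: ExecSeq ex ex2.
(* Weights in the kernel may be long; its encoding is bounded by the size of the input plus the time
   spent producing it. *)
have := exec_size ex 0; rewrite s0 updateE.
have -> : tsize (enc_instance S' k') = @esize inst_encType (instance_of S' k').
  by rewrite /esize encode_instance.
have x2 : 2 <= tsize (enc_instance S k) by rewrite /enc_instance [tsize _]/=; lia.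
rewrite size_nseq in tQ; move: tQ.
move: (tsize (enc_instance S k)) (@esize inst_encType _) x2 tP => x y x2 tP tQ yx.
have kL : k ^ 2 <= 4 ^ up_log 2 k.+1.
  by rewrite -(expnM 2 2) mulnC expnM expn_mono //; apply: ltnW; exact: up_logP.
set F := 2 ^ _.
have F0 : 0 < F by rewrite expn_gt0.
have tenF : (10 ^ nvar S') ^ e <= F.
  apply: (@leq_trans ((2 ^ 4) ^ (nvar S' * e))); first by rewrite -expnM expn_mono.
  rewrite -expnM leq_pexp2l // /D.
  have := leq_mul (leq_trans nS' (leq_mul (leqnn d) kL)) (leqnn e); nia.
have y_le : y <= (c + 1) * x ^ (c + 1).
  apply: leq_trans yx _; apply: (@leq_trans (x ^ (c + 1) + c * x ^ (c + 1))); last by lia.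
  apply: leq_add; first by rewrite -[leqLHS]expn1 leq_pexp2l //; lia.
  by apply: leq_trans tP _; rewrite leq_mul2l leq_pexp2l ?orbT //; lia.
have t2F : t2 <= F * (e * (c + 1) ^ e * x ^ ((c + 1) * e)).
  apply: leq_trans tQ _; rewrite expnMn [e * _]mulnCA leq_mul //.
  by rewrite -mulnA leq_mul2l expnM -expnMn expn_mono ?orbT.
have xG p : p <= G -> x ^ p <= x ^ G by move=> pG; rewrite leq_pexp2l //; lia.
have b1 : t1 <= F * (c * x ^ G).
  apply: leq_trans tP _; apply: leq_trans (leq_pmull _ F0).
  by rewrite leq_mul2l xG ?orbT // /G; lia.
have b2 : t2 <= F * (e * (c + 1) ^ e * x ^ G).
  apply: leq_trans t2F _; rewrite leq_mul2l leq_mul2l xG ?orbT // /G; lia.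
have b3 : 1 <= F * x ^ G by rewrite muln_gt0 F0 expn_gt0; lia.
have b4 : G <= x ^ G.
  by apply: leq_trans (ltnW (ltn_expl G (isT : 1 < 2))) _; rewrite expn_mono.
have : F * (G * x ^ G) <= F * x ^ (G + G) by rewrite expnD leq_mul2l leq_mul2r b4 !orbT.
apply: leq_trans; rewrite {1}/G.
move: (x ^ G) b1 b2 b3 => q b1 b2 b3; nia.
Qed.

(** * Restriction to a set of columns *)

Definition spans (S : system) (P : {set 'I_(nvar S)}) : Prop :=
  forall z : 'I_(nvar S) -> 'F_2, exists z' : 'I_(nvar S) -> 'F_2,
    (forall i, i \notin P -> z' i = 0%R) /\
    forall j : 'I_(neqn S), (\sum_(i in vars j) z' i = \sum_(i in vars j) z i)%R.

Lemma restrict_neq0 (S : system) (P : {set 'I_(nvar S)})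
    (H : forall j : 'I_(neqn S), vars j :&: P != set0) (j : 'I_(neqn S)) :
  [set i : 'I_#|P| | enum_val i \in vars j] != set0.
Proof.
have /set0Pn[i] := H j; rewrite inE => /andP[ij iP].
by apply/set0Pn; exists (enum_rank_in iP i); rewrite inE enum_rankK_in.
Qed.

Definition restrict (S : system) (P : {set 'I_(nvar S)})
    (H : forall j : 'I_(neqn S), vars j :&: P != set0) : system :=
  @System #|P| (neqn S) (fun j => [set i : 'I_#|P| | enum_val i \in vars j])
    (@rhs S) (@weight S) (restrict_neq0 H) (@weight_gt0 S).

Arguments restrict : clear implicits.

Lemma sum_delta n (A : {set 'I_n}) i :
  (\sum_(l in A) (l == i)%:R = (i \in A)%:R :> 'F_2)%R.
Proof.
rewrite big_mkcond (bigD1 i) //= eqxx big1 ?addr0; first by case: (i \in A).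
by move=> l /negPf->; case: ifP.
Qed.

(** Setting a single variable of equation [j] gives its left-hand side the value 1; an assignment
    supported on [P] reproduces this value, so [P] meets the equation. *)
Lemma spans_neq0 (S : system) (P : {set 'I_(nvar S)}) : spans P ->
  forall j : 'I_(neqn S), vars j :&: P != set0.
Proof.
move=> sp j; apply/negP => /eqP e0; have /set0Pn[i ij] := vars_neq0 j.
have [z' [z'0 /(_ j)]] := sp (fun l => (l == i)%:R)%R.
rewrite sum_delta ij big1 // => l lj; apply: z'0; apply/negP => lP.
have : l \in vars j :&: P by rewrite inE lj.
by rewrite e0 inE.
Qed.

Section Restrict.

Variables (S : system) (P : {set 'I_(nvar S)}) (sp : spans P).
Let S' := restrict S P (spans_neq0 sp).

Lemma sum_restrict (z : 'I_(nvar S) -> 'F_2) (j : 'I_(neqn S)) :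
  (forall i, i \notin P -> z i = 0%R) ->
  (\sum_(i in vars j) z i = \sum_(i in vars (j : 'I_(neqn S'))) z (enum_val i))%R.
Proof.
move=> z0; rewrite (bigID (mem P)) /= [X in (_ + X)%R]big1 ?addr0; last first.
  by move=> i /andP[_]; exact: z0.
under eq_bigl do rewrite andbC.
by rewrite big_enum_val_cond; apply: eq_bigl => i; rewrite inE.
Qed.

Lemma sum_restrict_lift (y : 'I_(nvar S') -> 'F_2) : exists2 z : 'I_(nvar S) -> 'F_2,
  (forall i, i \notin P -> z i = 0%R) & forall l, z (enum_val l) = y l.
Proof.
exists (fun i => \sum_(l < #|P| | enum_val l == i) y l)%R.
  move=> i iP; apply: big1 => l /eqP li.
  by rewrite -li enum_valP in iP.
move=> l; rewrite (bigD1 l) //= big1 ?addr0 // => l' /andP[/eqP/enum_val_inj->].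
by rewrite eqxx.
Qed.

Lemma restrict_linalb k : linalb S k <-> linalb S' k.
Proof.
split=> [[z Hz]|[y Hy]].
  have [z' [z'0 eqz]] := sp z; exists (fun l => z' (enum_val l)).
  congr (is_true (_ <= _)%R): Hz; congr (_%:R)%R; apply: eq_bigl => j.
  by rewrite /satisfies -eqz sum_restrict.
have [z z0 zy] := sum_restrict_lift y; exists z.
congr (is_true (_ <= _)%R): Hy; congr (_%:R)%R; apply: eq_bigl => j.
rewrite /satisfies sum_restrict //; congr (_ == _); apply: eq_bigr => i _.
by rewrite zy.
Qed.

(** Each column i is a sum of columns in [P]. Rows that agree on [P] therefore agree at i. *)
Lemma restrict_reduced : reduced S -> reduced S'.
Proof.
move=> rS j1 j2 e; apply: rS; apply/setP => i.
have [z' [z'0 eqz]] := sp (fun l => (l == i)%:R)%R.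
have H j := esym (etrans (eqz j) (sum_delta (vars j) i)).
have : ((i \in @vars S j1)%:R = (i \in @vars S j2)%:R :> 'F_2)%R.
  by rewrite !H (sum_restrict j1 z'0) (sum_restrict j2 z'0) e.
exact: toF_inj.
Qed.

End Restrict.

Lemma map_enum_val (T : finType) (A : {set T}) :
  [seq enum_val i | i <- enum 'I_#|A|] = enum A.
Proof.
have sz : size [seq enum_val i | i <- enum 'I_#|A|] = size (enum A).
  by rewrite size_map size_enum_ord cardE.
case E: (enum A) => [|x0 s]; first by apply/size0nil; rewrite sz E.
rewrite -E; apply: (@eq_from_nth _ x0) => // i; rewrite size_map size_enum_ord => lti.
rewrite (nth_map (Ordinal lti)) ?size_enum_ord // (enum_val_nth x0).
by rewrite nth_enum_ord.
Qed.

Lemma mask_nth T (m : bitseq) (s : seq T) (f : T -> bool) :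
  m = [seq f i | i <- s] -> mask m s = filter f s.
Proof. by move=> ->; rewrite filter_mask. Qed.

(** [enum_val] renumbers the columns of [P] in increasing order, which is the order in which [mask]
    keeps them. *)
Lemma instance_restrict (S : system) (m : bitseq) k
    (P := [set i : 'I_(nvar S) | nth false m i]) (sp : spans P) :
  size m = nvar S ->
  instance_of (restrict S P (spans_neq0 sp)) k =
  (mask m (instance_of S k).1,
   ([seq (mask m e.1, e.2) | e <- (instance_of S k).2.1], (instance_of S k).2.2)).
Proof.
move=> szm; have mE : m = [seq nth false m i | i : 'I_(nvar S) <- enum 'I_(nvar S)].
  rewrite -[LHS](mkseq_nth false) szm /mkseq -val_enum_ord -map_comp //.
have maskE : mask m (enum 'I_(nvar S)) = enum P.
  rewrite (mask_nth mE) [in RHS]/enum_mem -enumT; apply: eq_filter => i.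
  by apply/esym; exact: (in_set (fun i : 'I_(nvar S) => nth false m i)).
have cP : #|P| = count id m.
  by rewrite cardE -maskE size_mask // size_enum_ord.
rewrite /instance_of /=; congr (_, (_, _)).
  rewrite cP; apply: (@eq_from_nth _ tt); rewrite ?size_nseq ?size_mask ?size_nseq //.
  by move=> i _; case: (nth _ _ _); case: (nth _ _ _).
rewrite -map_comp; apply: eq_map => j /=; congr (_, _).
rewrite -map_mask maskE -map_enum_val -[in RHS]map_comp; apply: eq_map => i /=.
by rewrite inE.
Qed.

(** * The kernel with quadratically many equations and variables *)

Definition yes_system : system :=
  @System 1 1 (fun=> setT) (fun=> 0%R) (fun=> 2)
    (fun=> ltac:(by apply/set0Pn; exists ord0)) (fun=> isT).

Lemma yes_linalb : linalb yes_system 1.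
Proof.
exists (fun=> 0%R).
rewrite /total_weight /sat_weight big_ord1 (eq_bigl predT) ?big_ord1; first by rewrite /=; lra.
by move=> j; rewrite /satisfies big1 ?eqxx.
Qed.

Lemma pivot_spans (S : system) k (m := instance_mask (instance_of S k)) :
  [/\ size m = nvar S, count id m <= neqn S & spans [set i : 'I_(nvar S) | nth false m i]].
Proof.
pose rows := [seq row j | j <- enum 'I_(neqn S)].
have mE : m = pivot_mask (nseq (nvar S) tt) rows.
  by rewrite /m /instance_mask /= -map_comp.
have sr : size rows = neqn S by rewrite size_map size_enum_ord.
have [] := @pivot_spec (nvar S) rows rows [seq false | _ <- nseq (nvar S) tt] erefl.
- by rewrite size_map size_nseq.
- by apply/allP => r /mapP[j _ ->]; rewrite size_row.
rewrite -[foldl _ _ _]/(foldl _ _ _) /= -/(pivot_mask (nseq (nvar S) tt) rows) -mE.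
move=> szm _; rewrite map_nseq count_nseq_false sr => cnt ex; split=> // z.
have [|z' [sz' sub eqz]] := ex [seq z i != 0%R | i <- enum 'I_(nvar S)].
  by rewrite size_map size_enum_ord.
exists (fun i => toF (nth false z' i)); split.
  by move=> i; rewrite inE => /negP nm; case E: (nth false z' i) => //; case: nm; exact: sub.
move=> j; rewrite -toF_dots_row eqz; last by apply: map_f; rewrite mem_enum.
by rewrite toF_dots_row; apply: eq_bigr => i _; rewrite nth_map_enum toF_neq0.
Qed.

(** With L the bit length of k, 4^L lies between k^2 and 4k^2. Passing the test m >= (K+1) 4^L thus
    gives m >= (K+1) k^2, and failing it gives m < 4 (K+1) k^2. The third premise assumes an
    equation because classes such as r = 0 contain only systems without equations, hence not
    [yes_system]; the positive threshold provides the equation. *)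
Lemma quadratic_kernel (C : system -> Prop) (K : nat) :
  (forall S k, reduced S -> C S -> 0 < k -> K.+1 * k ^ 2 <= neqn S -> linalb S k) ->
  (forall S (P : {set 'I_(nvar S)}) (sp : spans P),
     C S -> C (restrict S P (spans_neq0 sp))) ->
  (forall S, C S -> 0 < neqn S -> C yes_system) ->
  quadratic_kernel_on C.
Proof.
move=> big Crestr Cyes.
have [P [n [T [[c cT] [n0 HP]]]]] := polyf_kernel K (instance_of yes_system 1).
exists P, c, (4 * K.+1) => S k rS CS k0.
have [|t [s [ex s0 _ tT]]] := HP (update (fun=> Leaf) 0 (enc_instance S k)) (instance_of S k).
  by rewrite updateE encode_instance.
have tc : t <= c * tsize (enc_instance S k) ^ c.
  by apply: leq_trans tT (leq_trans (cT _) _); rewrite /esize encode_instance.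
have L1 : k ^ 2 <= 4 ^ up_log 2 k.+1.
  by rewrite -(expnM 2 2) mulnC expnM expn_mono //; apply: ltnW; exact: up_logP.
have L2 : 4 ^ up_log 2 k.+1 <= 4 * k ^ 2.
  have : 2 ^ (up_log 2 k.+1).-1 <= k by rewrite -ltnS up_log_gtn.
  have : 0 < up_log 2 k.+1 by rewrite up_log_gt0.
  case: (up_log _ _) => // l _ /= le.
  by rewrite expnS leq_mul2l /= -(expnM 2 2) mulnC expnM expn_mono.
have szE : size (instance_of S k).2.1 = neqn S by rewrite size_map size_enum_ord.
move: s0; rewrite /kernel many_eqnsE szE size_bits; case: ifP => [le|/negbT nle] s0.
  exists t, yes_system, 1; split=> //.
  - by exists s => //; rewrite s0 encode_instance.
  - split=> //; first by move=> j1 j2 _; rewrite !ord1.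
    apply: (Cyes S) => //; apply: leq_trans le; by rewrite muln_gt0 expn_gt0.
  - split=> _; first exact: yes_linalb.
    by apply: big => //; apply: leq_trans le; rewrite leq_mul2l L1 orbT.
  - by rewrite /= muln_gt0 expn_gt0 k0.
have [szm cnt sp] := pivot_spans S k.
have sE := instance_restrict k sp szm.
exists t, (restrict S _ (spans_neq0 sp)), k; split=> //.
- by exists s => //; rewrite s0 -encode_instance sE.
- by split; [exact: restrict_reduced | exact: Crestr | rewrite k0 leqnn].
- exact: restrict_linalb.
- have mk : neqn S <= 4 * K.+1 * k ^ 2.
    rewrite -ltnNge in nle; apply: leq_trans (ltnW nle) _.
    by rewrite [4 * _]mulnC -mulnA leq_mul2l L2.
  split=> //; apply: leq_trans mk; apply: leq_trans cnt.
  rewrite /= -[#|_|](size_nseq _ tt).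
  have := congr1 (fun i : inst => size i.1) sE; rewrite /= => ->.
  by rewrite size_mask // size_nseq.
Qed.

(** * Moments of the excess *)

Local Open Scope ring_scope.

Definition chi (x : 'F_2) : int := if x == 0 then 1 else -1.

Lemma F2_cases (x : 'F_2) : x = 0 \/ x = 1.
Proof. by rewrite -(toF_neq0 x); case: (x != 0); [right | left]. Qed.

Lemma chiD x y : chi (x + y) = chi x * chi y.
Proof. by have [] := F2_cases x; have [] := F2_cases y => -> ->. Qed.

Lemma chi_sq x : chi x * chi x = 1.
Proof. by have [] := F2_cases x => ->. Qed.

(** * Characters of the cube: Parseval and Bonami's inequality *)

Section Characters.

Variable n : nat.
Local Notation asg := {ffun 'I_n -> 'F_2}.
Implicit Types (A : {set 'I_n}) (z w : asg).

Definition xi A z : int := chi (\sum_(i in A) z i).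

Definition delta (v : 'I_n) : asg := [ffun i => (i == v)%:R].

(** Expectations are kept as integer sums over all assignments; powers of [ncube] in the
    inequalities are the cleared denominators. *)
Definition ncube : int := #|{: asg}|%:R.

Lemma ncube_gt0 : 0 < ncube.
Proof. by rewrite ltr0n; apply/card_gt0P; exists 0. Qed.

Lemma sum_cube_const (k : int) : \sum_(z : asg) k = ncube * k.
Proof. by rewrite sumr_const mulr_natl. Qed.

Lemma xiD A z w : xi A (z + w) = xi A z * xi A w.
Proof.
by rewrite /xi -chiD -big_split; congr chi; apply: eq_bigr => i _; rewrite ffunE.
Qed.

Lemma xi_delta A v : xi A (delta v) = if v \in A then -1 else 1.
Proof.
rewrite /xi; under eq_bigr do rewrite ffunE; rewrite sum_delta.
by case: (v \in A).
Qed.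

Lemma xi_sq A z : xi A z * xi A z = 1. Proof. exact: chi_sq. Qed.

Lemma sum_cube_shift (F : asg -> int) w : \sum_(z : asg) F (z + w) = \sum_z F z.
Proof. by rewrite [RHS](reindex_inj (addIr w)). Qed.

(** Translation by [w] permutes the cube, so the sum equals its own negative. All orthogonality
    relations come from this, mostly with [w] flipping one variable. *)
Lemma sum_cube_anti (F : asg -> int) w : (forall z, F (z + w) = - F z) ->
  \sum_z F z = 0.
Proof.
move=> H; have := sum_cube_shift F w; under eq_bigr do rewrite H.
by rewrite sumrN; move: (\sum_z F z) => s; lia.
Qed.

Lemma neq_set_witness A B : A != B -> exists v, (v \in A) (+) (v \in B).
Proof.
move=> neq; apply/existsP; apply: contraNT neq => /existsPn H.
apply/eqP/setP => v; have := H v.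
by case: (v \in A) (v \in B) => [] [].
Qed.

Section Family.

Variable m : nat.
Implicit Types (c : 'I_m -> int) (I : 'I_m -> {set 'I_n}).

Definition lin c I z : int := \sum_j c j * xi (I j) z.

Lemma sum_lin c I : (forall j, I j != set0) -> \sum_z lin c I z = 0.
Proof.
move=> I0; rewrite exchange_big /=; apply: big1 => j _.
have /set0Pn[v vj] := I0 j; apply: (@sum_cube_anti _ (delta v)) => z.
by rewrite xiD xi_delta vj mulrN1 mulrN.
Qed.

(** Parseval: for two different sets some variable lies in exactly one of them, and flipping it
    negates the product of their characters. *)
Lemma sum_lin2 c I : injective I ->
  \sum_z lin c I z ^+ 2 = ncube * \sum_j c j ^+ 2.
Proof.
move=> injI.
have E z : lin c I z ^+ 2 = \sum_a \sum_b c a * c b * (xi (I a) z * xi (I b) z).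
  rewrite expr2 /lin big_distrlr /=.
  by apply: eq_bigr => a _; apply: eq_bigr => b _; ring.
under eq_bigr do rewrite E; rewrite exchange_big mulr_sumr /=; apply: eq_bigr => a _.
rewrite exchange_big (bigD1 a) //= [X in _ + X]big1 ?addr0.
  under eq_bigr do rewrite xi_sq mulr1.
  by rewrite sum_cube_const expr2.
move=> b ba; have /neq_set_witness[v va] : I a != I b.
  by apply: contraNneq ba => /injI->.
apply: (@sum_cube_anti _ (delta v)) => z; rewrite !xiD !xi_delta.
by case: (v \in I a) (v \in I b) va => [] [] //= _; ring.
Qed.

(** Lagrange's identity writes twice the gap as a double sum of squares, which avoids any
    division. *)
Lemma cauchy_schwarz (f g : asg -> int) :
  (\sum_z f z * g z) ^+ 2 <= (\sum_z f z ^+ 2) * (\sum_z g z ^+ 2).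
Proof.
have H : 0 <= \sum_x \sum_y (f x * g y - f y * g x) ^+ 2.
  by apply: sumr_ge0 => x _; apply: sumr_ge0 => y _; exact: sqr_ge0.
have E : \sum_x \sum_y (f x * g y - f y * g x) ^+ 2 =
   2 * ((\sum_z f z ^+ 2) * (\sum_z g z ^+ 2) - (\sum_z f z * g z) ^+ 2).
  transitivity (\sum_x \sum_y (f x ^+ 2 * g y ^+ 2 + g x ^+ 2 * f y ^+ 2
      - 2 * ((f x * g x) * (f y * g y)))).
    by apply: eq_bigr => x _; apply: eq_bigr => y _; ring.
  rewrite (eq_bigr (fun x => \sum_y f x ^+ 2 * g y ^+ 2 + \sum_y g x ^+ 2 * f y ^+ 2
      - 2 * \sum_y (f x * g x) * (f y * g y))); last first.
    by move=> x _; rewrite mulr_sumr -big_split -sumrB.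
  rewrite sumrB big_split -mulr_sumr /= expr2 !big_distrlr /=.
  rewrite [X in _ + X - _]exchange_big /=.
  have -> : \sum_x \sum_y g y ^+ 2 * f x ^+ 2 = \sum_x \sum_y f x ^+ 2 * g y ^+ 2.
    by apply: eq_bigr => x _; apply: eq_bigr => y _; rewrite mulrC.
  move: (\sum_x _) (\sum_x _) => p q; ring.
move: H; rewrite E; move: (\sum_z _) (\sum_z _) (\sum_z _) => p q r.
by rewrite pmulr_rge0 // subr_ge0.
Qed.

Lemma lin_const c I : (forall j, c j != 0 -> I j = set0) ->
  forall z, lin c I z = \sum_j c j.
Proof.
move=> H z; apply: eq_bigr => j _.
by have [->|/H->] := eqVneq (c j) 0; rewrite ?mul0r // /xi big_set0 mulr1.
Qed.

(* Bonami's inequality.  Splitting off a variable v, lin = f + chi (z v) * g with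
   f, g independent of v, so odd powers of chi (z v) average out and
   E[f^2 g^2] is handled by Cauchy-Schwarz. *)
Lemma bonami k : forall (V : {set 'I_n}) r c I, (#|V| <= k)%N ->
  (forall j, I j \subset V) -> (forall j, c j != 0 -> (#|I j| <= r)%N) ->
  ncube * (\sum_z lin c I z ^+ 4) <= 9 ^+ r * (\sum_z lin c I z ^+ 2) ^+ 2.
Proof.
have base r c I : (forall j, c j != 0 -> I j = set0) ->
    ncube * (\sum_z lin c I z ^+ 4) <= 9 ^+ r * (\sum_z lin c I z ^+ 2) ^+ 2.
  move=> /lin_const E; under eq_bigr do rewrite E.
  under [in X in _ <= X]eq_bigr do rewrite E.
  rewrite !sum_cube_const; set s := \sum_j c j.
  have -> : ncube * (ncube * s ^+ 4) = 1 * (ncube * s ^+ 2) ^+ 2 by ring.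
  by rewrite ler_wpM2r ?sqr_ge0 // exprn_ege1.
elim: k => [|k IH] V r c I Vk IV Ir.
  apply: base => j _; apply/eqP; rewrite -subset0.
  by move: Vk (IV j); rewrite leqn0 cards_eq0 => /eqP->.
have [V0|/set0Pn[v vV]] := eqVneq V set0.
  by apply: base => j _; apply/eqP; rewrite -subset0 -V0.
case: r Ir => [|r] Ir.
  by apply: base => j cj; apply/eqP; rewrite -cards_eq0 -leqn0 Ir.
pose J j := I j :\ v.
(* Both parts keep the full index set and zero the foreign coefficients; this is why the degree is
   bounded only where [c j != 0]. As [J] may identify sets, the inequality is phrased with the
   second moment rather than with the squared coefficients. *)
pose cf j := if v \in I j then 0 else c j; pose cg j := if v \in I j then c j else 0.
pose f z := lin cf J z; pose g z := lin cg J z; pose x z := chi (z v).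
have E z : lin c I z = f z + x z * g z.
  rewrite /f /g /lin mulr_sumr -big_split; apply: eq_bigr => j _ /=.
  rewrite /cf /cg /J; case: ifP => vj.
    rewrite mul0r add0r mulrCA; congr (_ * _).
    by rewrite /xi (big_setD1 v) //= chiD.
  rewrite mul0r mulr0 addr0; congr (_ * xi _ _).
  by apply/setP => i; rewrite !inE; case: eqP => // ->; rewrite vj.
have shJ j z : xi (J j) (z + delta v) = xi (J j) z.
  by rewrite xiD xi_delta !inE eqxx mulr1.
have shf z : f (z + delta v) = f z by apply: eq_bigr => j _; rewrite shJ.
have shg z : g (z + delta v) = g z by apply: eq_bigr => j _; rewrite shJ.
have shx z : x (z + delta v) = - x z.
  by rewrite /x !ffunE eqxx chiD mulrN1.
have xx z : x z ^+ 2 = 1 by rewrite expr2 /x chi_sq.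
have S2 : \sum_z lin c I z ^+ 2 = \sum_z f z ^+ 2 + \sum_z g z ^+ 2.
  transitivity (\sum_z (f z ^+ 2 + g z ^+ 2 + x z * (2 * f z * g z))).
    apply: eq_bigr => z _; rewrite E.
    have -> : (f z + x z * g z) ^+ 2 =
      f z ^+ 2 + x z ^+ 2 * g z ^+ 2 + x z * (2 * f z * g z) by ring.
    by rewrite xx mul1r.
  rewrite !big_split /= [X in _ + X](sum_cube_anti (w := delta v)) ?addr0 // => z.
  by rewrite shf shg shx; ring.
have S4 : \sum_z lin c I z ^+ 4 =
    \sum_z f z ^+ 4 + 6 * (\sum_z f z ^+ 2 * g z ^+ 2) + \sum_z g z ^+ 4.
  transitivity (\sum_z (f z ^+ 4 + 6 * (f z ^+ 2 * g z ^+ 2) + g z ^+ 4 +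
      x z * (4 * f z ^+ 3 * g z + 4 * f z * g z ^+ 3))).
    apply: eq_bigr => z _; rewrite E.
    have -> : (f z + x z * g z) ^+ 4 = f z ^+ 4 + 6 * (x z ^+ 2 * (f z ^+ 2 * g z ^+ 2))
      + (x z ^+ 2) ^+ 2 * g z ^+ 4
      + x z * (4 * f z ^+ 3 * g z + 4 * f z * g z ^+ 3 * x z ^+ 2) by ring.
    by rewrite xx; ring.
  rewrite !big_split /= -mulr_sumr [X in _ + X](sum_cube_anti (w := delta v)) ?addr0 // => z.
  by rewrite shf shg shx; ring.
have JV j : J j \subset V :\ v by apply: setSD.
have Vk' : (#|V :\ v| <= k)%N by move: Vk; rewrite (cardsD1 v V) vV.
(* Removing [v] lowers the degree only for [g]; this gains a factor 9 in its bound. *)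
have IHf : ncube * (\sum_z f z ^+ 4) <= 9 ^+ r.+1 * (\sum_z f z ^+ 2) ^+ 2.
  apply: IH Vk' JV _ => j; rewrite /cf; case: ifP => [_|vj cj]; first by rewrite eqxx.
  by apply: leq_trans (Ir j cj); rewrite subset_leq_card // subD1set.
have IHg : ncube * (\sum_z g z ^+ 4) <= 9 ^+ r * (\sum_z g z ^+ 2) ^+ 2.
  apply: IH Vk' JV _ => j; rewrite /cg; case: ifP => [vj cj|_]; last by rewrite eqxx.
  by have := Ir j cj; rewrite (cardsD1 v (I j)) vj.
have CS := cauchy_schwarz (fun z => f z ^+ 2) (fun z => g z ^+ 2).
rewrite S2 S4.
have sumX4 (h : asg -> int) : \sum_z (h z ^+ 2) ^+ 2 = \sum_z h z ^+ 4.
  by apply: eq_bigr => z _; rewrite -exprM.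
rewrite /= !sumX4 in CS.
have a0 : 0 <= \sum_z f z ^+ 2 by apply: sumr_ge0 => z _; exact: sqr_ge0.
have b0 : 0 <= \sum_z g z ^+ 2 by apply: sumr_ge0 => z _; exact: sqr_ge0.
have f40 : 0 <= \sum_z f z ^+ 4 by rewrite -sumX4; apply: sumr_ge0 => z _; exact: sqr_ge0.
have g40 : 0 <= \sum_z g z ^+ 4 by rewrite -sumX4; apply: sumr_ge0 => z _; exact: sqr_ge0.
have m0 : 0 <= \sum_z f z ^+ 2 * g z ^+ 2.
  by apply: sumr_ge0 => z _; rewrite mulr_ge0 ?sqr_ge0.
have N0 := ncube_gt0.
move: (\sum_z f z ^+ 2) (\sum_z g z ^+ 2) (\sum_z f z ^+ 4) (\sum_z g z ^+ 4)
  (\sum_z f z ^+ 2 * g z ^+ 2) ncube IHf IHg CS a0 b0 f40 g40 m0 N0.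
move=> a b f4 g4 w N IHf IHg CS a0 b0 f40 g40 w0 N0.
have q0 : 0 < 9 ^+ r :> int by rewrite exprn_gt0.
rewrite exprS in IHf *; move: (9 ^+ r : int) q0 IHf IHg => q q0 IHf IHg.
(* The geometric mean of the two bounds 9q a^2 and q b^2. Six times 3q ab equals 18q ab, the cross
   term of 9q (a + b)^2; this is what fixes the base 9. *)
have wle : N * w <= 3 * q * a * b.
  rewrite -(@ler_pXn2r _ 2) ?nnegrE ?mulr_ge0 ?(ltW N0) ?(ltW q0) //.
  apply: (@le_trans _ _ ((N * f4) * (N * g4))).
    have -> : N * f4 * (N * g4) = N ^+ 2 * (f4 * g4) by ring.
    by rewrite exprMn ler_wpM2l ?sqr_ge0.
  have -> : (3 * q * a * b) ^+ 2 = (9 * q * a ^+ 2) * (q * b ^+ 2) by ring.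
  by apply: ler_pM => //; rewrite mulr_ge0 // ltW.
have -> : N * (f4 + 6 * w + g4) = N * f4 + 6 * (N * w) + N * g4 by ring.
have -> : 9 * q * (a + b) ^+ 2 = 9 * q * a ^+ 2 + 18 * (q * a * b) + 9 * (q * b ^+ 2) by ring.
have : 0 <= q * b ^+ 2 by rewrite mulr_ge0 ?sqr_ge0 // ltW.
have wE : 3 * q * a * b = 3 * (q * a * b) by ring.
rewrite wE in wle.
by move: (q * a * b) (q * b ^+ 2) (9 * q * a ^+ 2) (N * w) (N * f4) (N * g4) IHf IHg wle; lia.
Qed.

End Family.

End Characters.

(** * The fourth moment when each variable occurs in few equations *)

Section BoundedOccurrence.

Variables (n m rho : nat) (c : 'I_m -> int) (I : 'I_m -> {set 'I_n}).
Hypothesis injI : injective I.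
Hypothesis occ : forall v, (#|[set j | v \in I j]| <= rho)%N.

Local Notation pairT := ('I_m * 'I_m)%type.
Implicit Types p q : pairT.

(** Membership of [v] in the symmetric difference of the two sets of the pair [p]. The product
    [xp p] of their characters is the character of that difference, so the square of [lin] is the
    sum of [g p * xp p]. *)
Let inS v p := (v \in I p.1) (+) (v \in I p.2).
Let sim p q := [forall v, inS v p == inS v q].
Let g p := c p.1 * c p.2.
Let xp p z := xi (I p.1) z * xi (I p.2) z.

Let xp_delta p v : xp p (delta v) = if inS v p then -1 else 1.
Proof. by rewrite /xp /inS !xi_delta; case: (v \in I p.1) (v \in I p.2) => [] []. Qed.

Let xi_norm A (z : {ffun 'I_n -> 'F_2}) : `|xi A z| = 1.
Proof. by rewrite /xi /chi; case: ifP. Qed.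

Let simC p q : sim p q = sim q p.
Proof. by apply: eq_forallb => v; rewrite eq_sym. Qed.

Let sim_diag a q : sim (a, a) q = (q.1 == q.2).
Proof.
apply/idP/eqP => [/forallP H|e].
  apply: injI; apply/setP => v; have := H v; rewrite /inS /= addbb.
  by case: (v \in I q.1) (v \in I q.2) => [] [].
by apply/forallP => v; rewrite /inS /= addbb e addbb.
Qed.

Let sum_sim p q : \sum_z g p * g q * (xp p z * xp q z) <=
  @ncube n * (if sim p q then `|g p| * `|g q| else 0).
Proof.
case: ifP => [_|/negbT].
  rewrite -sum_cube_const; apply: ler_sum => z _; apply: le_trans (ler_norm _) _.
  by rewrite !normrM !xi_norm !mulr1.
rewrite negb_forall => /existsP[v nv]; rewrite mulr0 (sum_cube_anti (w := delta v)) // => z.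
rewrite -mulrN; congr (_ * _).
have xpD r : xp r (z + delta v) = xp r z * xp r (delta v).
  by rewrite /xp !xiD; ring.
rewrite !xpD !xp_delta.
by case: (inS v p) (inS v q) nv => [] [] //= _; ring.
Qed.

(** Fix [v] in the symmetric difference of [p]. For [q] with the same difference, [v] lies in one of
    the two sets of [q], which leaves at most [rho] choices for that set; the other is then
    determined. The factor 2 counts which of the two contains [v]. *)
Let card_sim p : p.1 != p.2 -> (#|[set q | sim p q]| <= 2 * rho)%N.
Proof.
move=> np; have /neq_set_witness[v vp] : I p.1 != I p.2.
  by apply: contraNneq np => /injI->.
pose A1 := [set q | sim p q & v \in I q.1]; pose A2 := [set q | sim p q & v \in I q.2].
have simP q : sim p q -> forall u, inS u q = inS u p.
  by move=> /forallP H u; apply/esym/eqP.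
have sub : [set q | sim p q] \subset A1 :|: A2.
  apply/subsetP => q; rewrite !inE => pq; rewrite pq /=.
  have := simP q pq v; rewrite /inS vp.
  by case: (v \in I q.1) (v \in I q.2) => [] [].
have c1 : (#|A1| <= rho)%N.
  rewrite -(card_in_imset (f := fst)).
    apply: leq_trans (occ v); apply/subset_leq_card/subsetP => a /imsetP[q].
    by rewrite !inE => /andP[_ ?] ->.
  move=> [a b] [a' b']; rewrite !inE => /andP[s1 _] /andP[s2 _] /= e; rewrite -e in s2 *.
  congr pair; apply: injI; apply/setP => u.
  have := simP _ s1 u; rewrite -(simP _ s2 u) /inS /=.
  by case: (u \in I a) (u \in I b) (u \in I b') => [] [] [].
have c2 : (#|A2| <= rho)%N.
  rewrite -(card_in_imset (f := snd)).
    apply: leq_trans (occ v); apply/subset_leq_card/subsetP => a /imsetP[q].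
    by rewrite !inE => /andP[_ ?] ->.
  move=> [a b] [a' b']; rewrite !inE => /andP[s1 _] /andP[s2 _] /= e; rewrite -e in s2 *.
  congr pair; apply: injI; apply/setP => u.
  have := simP _ s1 u; rewrite -(simP _ s2 u) /inS /=.
  by case: (u \in I a) (u \in I b) (u \in I a') => [] [] [].
apply: leq_trans (subset_leq_card sub) _; rewrite cardsU.
by move: c1 c2; lia.
Qed.

Let sum_g2 : \sum_p g p ^+ 2 = (\sum_j c j ^+ 2) ^+ 2.
Proof.
rewrite expr2 big_distrlr /= pair_bigA /=.
by apply: eq_bigr => -[a b] _; rewrite /g exprMn.
Qed.

(** Only pairs with equal symmetric differences contribute. Diagonal pairs match exactly each other
    and yield the summand 1; every other pair has at most 2 rho partners. *)
Lemma fourth_moment_occ :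
  \sum_z lin c I z ^+ 4 <= @ncube n * ((1 + 2 * rho)%N%:R * (\sum_j c j ^+ 2) ^+ 2).
Proof.
have E z : lin c I z ^+ 4 = \sum_p \sum_q g p * g q * (xp p z * xp q z).
  have -> : lin c I z ^+ 4 = (lin c I z ^+ 2) ^+ 2 by rewrite -exprM.
  have -> : lin c I z ^+ 2 = \sum_p g p * xp p z.
    rewrite expr2 /lin big_distrlr /= pair_bigA /=; apply: eq_bigr => -[a b] _ /=.
    by rewrite /g /xp /=; ring.
  rewrite expr2 big_distrlr /=; apply: eq_bigr => p _; apply: eq_bigr => q _; ring.
under eq_bigr do rewrite E; rewrite exchange_big /=.
under eq_bigr do rewrite exchange_big /=.
apply: (@le_trans _ _ (\sum_p \sum_q @ncube n * (if sim p q then `|g p| * `|g q| else 0))).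
  by apply: ler_sum => p _; apply: ler_sum => q _; exact: sum_sim.
rewrite (eq_bigr (fun p => @ncube n * \sum_q (if sim p q then `|g p| * `|g q| else 0)));
  last by move=> p _; rewrite mulr_sumr.
rewrite -mulr_sumr ler_wpM2l ?(ltW (ncube_gt0 n)) //.
rewrite (bigID (fun p => p.1 == p.2)) /= natrD mulrDl mul1r lerD //.
  rewrite le_eqVlt; apply/orP; left; apply/eqP.
  transitivity (\sum_(p | p.1 == p.2) `|g p| * \sum_(q | q.1 == q.2) `|g q|).
    apply: eq_bigr => -[a b] /= /eqP <-; rewrite mulr_sumr [RHS]big_mkcond /=.
    by apply: eq_bigr => q _; rewrite sim_diag.
  rewrite -mulr_suml -expr2; congr (_ ^+ 2).
  rewrite (reindex_onto (fun a => (a, a)) fst) /=; last by move=> [a b] /= /eqP->.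
  apply: eq_big => [a|a _]; first by rewrite !eqxx.
  by rewrite /g /= -expr2 ger0_norm ?sqr_ge0.
rewrite -sum_g2; set T := \sum_(p | _) _.
pose U := \sum_(p | p.1 != p.2) \sum_(q | sim p q && (q.1 != q.2)) g p ^+ 2.
have nd p q : p.1 != p.2 -> sim p q -> q.1 != q.2.
  by move=> np; apply: contraTneq => e; rewrite simC; case: q e => a b /= <-; rewrite sim_diag.
(* 2|xy| <= x^2 + y^2, followed by the symmetry of [sim], charges each product to the square of its
   first pair. *)
have TU : 2 * T <= 2 * U.
  have -> : 2 * U = \sum_(p | p.1 != p.2) \sum_(q | sim p q && (q.1 != q.2)) (g p ^+ 2 + g q ^+ 2).
    rewrite mulr_natl mulr2n.
    under [in RHS]eq_bigr do rewrite big_split /=.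
    rewrite big_split /=; congr (_ + _); rewrite /U.
    rewrite (exchange_big_dep (fun q => q.1 != q.2)) /=; last by move=> p q _ /andP[].
    apply: eq_bigr => q nq; apply: eq_bigl => p.
    by rewrite nq andbT andbC simC.
  rewrite /T mulr_sumr; apply: ler_sum => p np; rewrite mulr_sumr.
  rewrite [X in _ <= X]big_mkcond /=; apply: ler_sum => q _.
  case: ifP => [pq|_]; last first.
    by rewrite mulr0; case: (_ && _); rewrite ?addr_ge0 ?sqr_ge0.
  rewrite (nd p q np pq) -(real_normK (num_real (g p))) -(real_normK (num_real (g q))).
  move: `|g p| `|g q| => x y; have := sqr_ge0 (x - y).
  have -> : (x - y) ^+ 2 = x ^+ 2 + y ^+ 2 - 2 * (x * y) by ring.
  by rewrite subr_ge0.
have {TU} TU : T <= U by move: TU; rewrite ler_pM2l.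
apply: le_trans TU _; rewrite /U mulr_sumr [X in _ <= X](bigID (fun p => p.1 != p.2)) /=.
apply: ler_wpDr; first by apply: sumr_ge0 => p _; rewrite mulr_ge0 ?sqr_ge0.
apply: ler_sum => p np; rewrite sumr_const -[leLHS]mulr_natl ler_wpM2r ?sqr_ge0 // ler_nat.
apply: leq_trans (card_sim np); apply/subset_leq_card/subsetP => q.
by rewrite !inE => /andP[].
Qed.

End BoundedOccurrence.

(* If lin < a everywhere then E|lin| <= 2a since the mean is 0, and interpolating
   x^2 <= l|x| + x^4/l^2 with l = sigma/(8a) contradicts the fourth moment bound. *)
Lemma exists_large n m (c : 'I_m -> int) (I : 'I_m -> {set 'I_n}) (K : nat) (a : int) :
  injective I -> (forall j, I j != set0) -> 0 < a ->
  @ncube n * (\sum_z lin c I z ^+ 4) <= K%:R * (\sum_z lin c I z ^+ 2) ^+ 2 ->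
  0 < \sum_j c j ^+ 2 -> 256 * K%:R * a ^+ 2 <= \sum_j c j ^+ 2 ->
  exists z, a <= lin c I z.
Proof.
move=> injI I0 a0 h4 s0 hs; apply/existsP; apply: contraT => /existsPn H.
have {}H z : lin c I z <= a by rewrite ltW // ltNge.
rewrite sum_lin2 // in h4; have h1 := sum_lin c I0; have h2 := sum_lin2 c injI.
have N0 := ncube_gt0 n.
move: (\sum_j c j ^+ 2) h2 h4 s0 hs => s h2 h4 s0 hs.
(* If x <= a then |x| + x <= 2a, and the x sum to zero. *)
have habs : \sum_z `|lin c I z| <= @ncube n * (2 * a).
  rewrite -[leLHS]addr0 -[X in _ + X]h1 -big_split -sum_cube_const; apply: ler_sum => z _ /=.
  by move: (lin c I z) (H z) => x; lia.
pose L := 8 * a.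
(* The interpolation for l = s/L, multiplied by L s^2 to stay in the integers. The first term
   dominates when L|x| <= s, the second otherwise. *)
have pt z : L * s ^+ 2 * lin c I z ^+ 2 <= s ^+ 3 * `|lin c I z| + L ^+ 3 * lin c I z ^+ 4.
  have -> : lin c I z ^+ 4 = (lin c I z ^+ 2) ^+ 2 by rewrite -exprM.
  rewrite -[lin c I z ^+ 2]real_normK ?num_real // -exprM.
  have y0 := normr_ge0 (lin c I z); move: `|_| y0 => y y0.
  have L0 : 0 < L by rewrite /L; lia.
  have [le|lt] := leP (L * y) s.
    apply: (@le_trans _ _ (s ^+ 3 * y)); last first.
      by rewrite lerDl mulr_ge0 ?exprn_ge0 ?(ltW L0).
    have -> : L * s ^+ 2 * y ^+ 2 = (s ^+ 2 * y) * (L * y) by ring.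
    have -> : s ^+ 3 * y = (s ^+ 2 * y) * s by ring.
    by rewrite ler_wpM2l // mulr_ge0 ?sqr_ge0.
  apply: (@le_trans _ _ (L ^+ 3 * y ^+ 4)); last first.
    by rewrite lerDr mulr_ge0 ?exprn_ge0 ?(ltW s0).
  have -> : L * s ^+ 2 * y ^+ 2 = (L * y ^+ 2) * s ^+ 2 by ring.
  have -> : L ^+ 3 * y ^+ 4 = (L * y ^+ 2) * (L * y) ^+ 2 by ring.
  apply: ler_wpM2l; first by rewrite mulr_ge0 ?sqr_ge0 // ltW.
  by rewrite !expr2; apply: ler_pM; rewrite ltW.
have : \sum_z L * s ^+ 2 * lin c I z ^+ 2 <=
    \sum_z (s ^+ 3 * `|lin c I z| + L ^+ 3 * lin c I z ^+ 4) by apply: ler_sum => z _.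
rewrite big_split -!mulr_sumr h2 /=.
move: (\sum_z `|lin c I z|) (\sum_z lin c I z ^+ 4) habs h4 => u v habs h4 hh; exfalso.
have {}hh : L * s ^+ 2 * (@ncube n * s) * @ncube n <=
    s ^+ 3 * (@ncube n * (2 * a)) * @ncube n + L ^+ 3 * (K%:R * (@ncube n * s) ^+ 2).
  apply: (@le_trans _ _ ((s ^+ 3 * u + L ^+ 3 * v) * @ncube n)).
    by rewrite ler_pM2r.
  rewrite mulrDl lerD //.
    by rewrite ler_pM2r // ler_wpM2l // exprn_ge0 // ltW.
  rewrite -mulrA [v * _]mulrC ler_wpM2l // exprn_ge0 // /L; lia.
move: (@ncube n) N0 hh => N N0.
have -> : L * s ^+ 2 * (N * s) * N = (N ^+ 2 * s ^+ 2) * (L * s) by ring.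
have -> : s ^+ 3 * (N * (2 * a)) * N + L ^+ 3 * (K%:R * (N * s) ^+ 2) =
  (N ^+ 2 * s ^+ 2) * (2 * a * s + L ^+ 3 * K%:R) by ring.
rewrite ler_pM2l ?mulr_gt0 ?exprn_gt0 //.
have -> : L ^+ 3 * K%:R = a * (512 * K%:R * a ^+ 2) by rewrite /L; ring.
have -> : 2 * a * s + a * (512 * K%:R * a ^+ 2) = a * (2 * s + 512 * K%:R * a ^+ 2) by ring.
have -> : L * s = a * (8 * s) by rewrite /L; ring.
(* What remains is 8s <= 2s + 512 K a^2, and the hypothesis with 256 bounds the right side by 4s,
   contradicting s > 0. *)
by rewrite ler_pM2l //; move: (a ^+ 2) hs => a2 hs; nia.
Qed.

(** * Many equations force a large excess *)

Section Excess.

Variables (S : system) (k : nat).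
Hypotheses (rS : reduced S) (k0 : (0 < k)%N).

Let c (j : 'I_(neqn S)) : int := (weight j)%:R * chi (rhs j).
Let X := lin c (@vars S).

Lemma chi_mul (x y : 'F_2) : chi x * chi y = if y == x then 1 else -1.
Proof. by have [] := F2_cases x; have [] := F2_cases y => -> ->. Qed.

Lemma excess_linalb z : (2 * k)%:R <= X z -> linalb S k.
Proof.
move=> h; exists z; rewrite linalb_nat -(ler_nat int) natrD.
have E : X z = (sat_weight z)%:R -
    (\sum_(j < neqn S | ~~ satisfies z j) weight j)%N%:R.
  rewrite /X /lin (bigID (satisfies z)) /= /sat_weight !natr_sum -sumrN.
  congr (_ + _); apply: eq_bigr => j; rewrite /satisfies /c /xi -mulrA chi_mul.
    by move=> ->; rewrite mulr1.
  by move=> /negPf->; rewrite mulrN1.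
by move: h; rewrite E lerBrDr.
Qed.

Lemma sum_c2 : (neqn S)%:R <= \sum_j c j ^+ 2.
Proof.
rewrite -[X in (X%:R)]card_ord -sum1_card natr_sum; apply: ler_sum => j _.
rewrite exprMn [chi _ ^+ 2]expr2 chi_sq mulr1 -natrX ler_nat expn_gt0.
by rewrite weight_gt0.
Qed.

Lemma large_of_odd : odd_on_some_set S -> (4 * k ^ 2 <= neqn S)%N -> linalb S k.
Proof.
move=> [U oU] mk; have [z hz] : exists z, (2 * k)%:R <= X z; last exact: excess_linalb hz.
apply/existsP; apply: contraT => /existsPn H.
pose u : {ffun 'I_(nvar S) -> 'F_2} := [ffun i => toF (i \in U)].
have xu (j : 'I_(neqn S)) : xi (vars j) u = -1.
  rewrite /xi; have -> : \sum_(i in vars j) u i = (#|vars j :&: U|)%:R.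
    rewrite -sum1_card natr_sum (bigID (mem U)) /= [X in _ + X]big1 ?addr0.
      apply: eq_big => [i|i /andP[_ iU]]; first by rewrite inE.
      by rewrite ffunE iU.
    by move=> i /andP[_ /negPf iU]; rewrite ffunE iU.
  have -> : (#|vars j :&: U|)%:R = 1 :> 'F_2.
    by rewrite -[#|_|]odd_double_half oU natrD -muln2 natrM pchar_Fp_0 ?mulr0 ?addr0.
  by [].
have Xu z : X (z + u) = - X z.
  by rewrite /X /lin -sumrN; apply: eq_bigr => j _; rewrite xiD xu; ring.
(* The sign change under [u] turns the one-sided bound into a two-sided one, so the second moment
   already gives the contradiction. *)
have lt z : X z ^+ 2 < (2 * k)%:R ^+ 2.
  have := H z; have := H (z + u); rewrite Xu -!ltNge => h1 h2.
  have : `|X z| < (2 * k)%:R by move: (X z) h1 h2 => x; lia.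
  by rewrite -(real_normK (num_real (X z))) ltr_pXn2r ?nnegrE.
have : \sum_z X z ^+ 2 < \sum_(z : {ffun 'I_(nvar S) -> 'F_2}) (2 * k)%:R ^+ 2.
  apply: ltr_sum => [|z _]; last exact: lt.
  by apply/hasP; exists 0; rewrite ?mem_index_enum.
rewrite sum_lin2 // sum_cube_const ltr_pM2l ?ncube_gt0 // ltNge.
move/negP; case; apply: le_trans sum_c2; rewrite -natrX ler_nat.
by rewrite expnMn.
Qed.

(** The target excess is a = 2k, whence 1024 = 256 * 2^2. Writing [K.+1] keeps the threshold
    positive for every [K], which makes the sum of the squared coefficients positive. *)
Lemma large_of_fourth (K : nat) :
  @ncube (nvar S) * (\sum_z X z ^+ 4) <= K%:R * (\sum_z X z ^+ 2) ^+ 2 ->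
  (1024 * K.+1 * k ^ 2 <= neqn S)%N -> linalb S k.
Proof.
move=> h4 mk; have hm := sum_c2.
have [|||z] := @exists_large _ _ c (@vars S) K (2 * k)%:R rS (@vars_neq0 S) _ h4.
- by rewrite ltr0n muln_gt0.
- apply: lt_le_trans hm; rewrite ltr0n; apply: leq_trans mk.
  by rewrite !muln_gt0 ?expn_gt0 ?k0.
- apply: le_trans hm; rewrite -natrX -!natrM ler_nat; apply: leq_trans mk.
  by rewrite expnMn; lia.
exact: excess_linalb.
Qed.

Lemma large_of_vars_per_eqn r : vars_per_eqn_le r S ->
  (1024 * (9 ^ r).+1 * k ^ 2 <= neqn S)%N -> linalb S k.
Proof.
move=> Sr; apply: large_of_fourth; rewrite natrX.
apply: (@bonami _ _ (nvar S) setT) => //.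
by rewrite cardsT card_ord.
Qed.

Lemma large_of_eqns_per_var rho : eqns_per_var_le rho S ->
  (1024 * (1 + 2 * rho).+1 * k ^ 2 <= neqn S)%N -> linalb S k.
Proof.
move=> Srho; apply: large_of_fourth; rewrite sum_lin2 //.
have := fourth_moment_occ c rS Srho; rewrite -(ler_pM2l (ncube_gt0 (nvar S))).
by move/le_trans; apply; rewrite le_eqVlt; apply/orP; left; apply/eqP; ring.
Qed.

End Excess.

(** * Closure of the classes under column restriction, and the three cases *)

Lemma spans_odd S (P : {set 'I_(nvar S)}) (sp : spans P) :
  odd_on_some_set S -> odd_on_some_set (restrict S P (spans_neq0 sp)).
Proof.
move=> [U oU].
have card_sum n (A B : {set 'I_n}) :
    \sum_(i in A) toF (i \in B) = toF (odd #|A :&: B|).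
  rewrite /toF -natr_sum -sum1_card (bigID (mem B)) /= [X in (_ + X)%N]big1 ?addn0.
    rewrite (eq_big (fun i => i \in A :&: B) (fun=> 1%N))
      => [|i|i /andP[_ ->]] //; last by rewrite inE.
    rewrite sum1_card -[in LHS](odd_double_half #|A :&: B|) natrD -muln2 natrM pchar_Fp_0 //.
    by rewrite mulr0 addr0.
  by move=> i /andP[_ /negPf->].
(* The set U is an assignment giving every left-hand side the value 1. An assignment supported on
   [P] with the same values exists, and its support is the new set. *)
have [z' [z'0 eqz]] := sp (fun i => toF (i \in U)).
exists [set l | z' (enum_val l) != 0] => j.
apply: toF_inj; rewrite -card_sum -[RHS]/(toF true) -(oU j) -card_sum -eqz.
rewrite (sum_restrict sp j z'0); apply: eq_bigr => i _; rewrite inE toF_neq0 //.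
Qed.

Lemma card_vars_restrict S (P : {set 'I_(nvar S)}) (sp : spans P)
  (j : 'I_(neqn S)) : (#|@vars (restrict S P (spans_neq0 sp)) j| <= #|vars j|)%N.
Proof.
rewrite -(card_imset _ (@enum_val_inj _ (mem P))).
by apply/subset_leq_card/subsetP => i /imsetP[l]; rewrite inE => lj ->.
Qed.

Theorem theorem2 :
  [/\ fpt_on odd_on_some_set /\ quadratic_kernel_on odd_on_some_set,
      (forall r : nat,
         fpt_on (vars_per_eqn_le r) /\ quadratic_kernel_on (vars_per_eqn_le r))
    & (forall rho : nat,
         fpt_on (eqns_per_var_le rho) /\
         quadratic_kernel_on (eqns_per_var_le rho))].
Proof.
have both C : quadratic_kernel_on C -> fpt_on C /\ quadratic_kernel_on C.
  by move=> H; split=> //; exact: fpt_of_kernel.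
split=> [|r|rho]; apply: both.
- apply: (@quadratic_kernel _ 3) => [S k rS CS k0|S P sp|S _ _].
  + exact: large_of_odd.
  + exact: spans_odd.
  + by exists setT => j; rewrite setIT cardsT card_ord.
- apply: (@quadratic_kernel _ (1024 * (9 ^ r).+1)) => [S k rS CS k0 le|S P sp CS j|S CS m0 j].
  + apply: (large_of_vars_per_eqn rS k0 CS); apply: leq_trans le.
    by rewrite leq_mul2r leqnSn orbT.
  + exact: leq_trans (card_vars_restrict sp j) (CS j).
  + rewrite cardsT card_ord; apply: leq_trans (CS (Ordinal m0)).
    by rewrite card_gt0 vars_neq0.
- apply: (@quadratic_kernel _ (1024 * (1 + 2 * rho).+1)) => [S k rS CS k0 le|S P sp CS i|S CS m0 i].
  + apply: (large_of_eqns_per_var rS k0 CS); apply: leq_trans le.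
    by rewrite leq_mul2r leqnSn orbT.
  + apply: leq_trans (CS (enum_val i)); apply/subset_leq_card/subsetP => j.
    by rewrite !inE.
  + have /set0Pn[v vj] := vars_neq0 (Ordinal m0).
    apply: (@leq_trans 1); first by apply: leq_trans (max_card _) _; rewrite card_ord.
    apply: leq_trans (CS v); rewrite card_gt0; apply/set0Pn.
    by exists (Ordinal m0); rewrite inE.
Qed.
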